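(* Let $\mathbb A$ be an algebra on $\mathbb R^n$, let $\varphi:U\subset\mathbb R^k\to\mathbb R^n$ be a $C^2$-function defined on an open set $U$, and let $F:\Omega\subset\mathbb R^n\to\mathbb R^n$ be an $\mathbb A$-differentiable vector field defined on an open set $\Omega$ with $\varphi(U)\subset\Omega$. Let $\tau_0\in U$. For every initial condition $w_0\in\Omega$ there exists a unique $\varphi\mathbb A$-differentiable function $w:V_{\tau_0}\to\mathbb R^n$, where $V_{\tau_0}\subset U$ is a neighborhood of $\tau_0$, such that $w(\tau_0)=w_0$ and $w$ solves the $\varphi\mathbb A$-differential equation $w'_\varphi=F(w)$, i.e. $dw_\tau=F(w(\tau))\,d\varphi_\tau$ for all $\tau\in V_{\tau_0}$.
   Context: An algebra $\mathbb A$ on $\mathbb R^n$ is the real linear space $\mathbb R^n$ with a bilinear, associative, commutative product having a unit $e$. For functions $f,\varphi:U\subset\mathbb R^k\to\mathbb R^n$ on an open set $U$, both differentiable in the usual sense, $f$ is $\varphi\mathbb A$-differentiable on $U$ if there is a function $f'_\varphi:U\to\mathbb R^n$ such that $df_u(\xi)=f'_\varphi(u)\,d\varphi_u(\xi)$ ($\mathbb A$-product) for all $u\in U$, $\xi\in\mathbb R^k$. When $k=n$ and $\varphi$ is the identity, this is called $\mathbb A$-differentiability (Lorch differentiability). The notation $dw_\tau=F(w(\tau))\,d\varphi_\tau$ means $dw_\tau(\xi)=F(w(\tau))\,d\varphi_\tau(\xi)$ ($\mathbb A$-product) for all $\xi\in\mathbb R^k$. *)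

(* Defs.v *)
From HB Require Import structures.
From mathcomp Require Import all_boot all_order all_algebra.
From mathcomp Require Import all_classical all_reals all_analysis.

Set Implicit Arguments.
Unset Strict Implicit.
Unset Printing Implicit Defensive.

Import Order.TTheory GRing.Theory Num.Theory.
Import numFieldNormedType.Exports.

Local Open Scope classical_set_scope.
Local Open Scope ring_scope.

(* The product is kept in a record rather than registered as a ring structure
   on 'rV[R]_n: one space carries many such algebras, and the unit is allowed
   to be any vector. *)
Record algebraOn (R : realType) (n : nat) := AlgebraOn {
  amul : 'rV[R]_n -> 'rV[R]_n -> 'rV[R]_n;
  aunit : 'rV[R]_n;
  amul_bilinear : bilinear_for *:%R *:%R amul;
  amulA : associative amul;
  amulC : commutative amul;
  amul1 : left_id aunit amul
}.

(* Functions on an open set are represented by total functions.  For u in an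
   open set, differentiability at u and 'd f u depend only on the germ of f
   at u, so the values outside the set are irrelevant. *)

(* C^m on an open set, by recursion on iterated differentials.  In finite
   dimension the regularity of u |-> 'd f u is that of u |-> 'd f u v for each
   direction v. *)
Fixpoint classC (R : realType) (k n m : nat) (U : set 'rV[R]_k)
    (f : 'rV[R]_k -> 'rV[R]_n) : Prop :=
  if m is m'.+1 then
    (forall u, U u -> differentiable f u) /\
    (forall v, classC m' U (fun u => 'd f u v))
  else forall u, U u -> {for u, continuous f}.

Definition phiA_differentiable (R : realType) (k n : nat) (A : algebraOn R n)
    (phi : 'rV[R]_k -> 'rV[R]_n) (U : set 'rV[R]_k)
    (f : 'rV[R]_k -> 'rV[R]_n) : Prop :=
  [/\ forall u, U u -> differentiable phi u,
      forall u, U u -> differentiable f u &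
      exists f' : 'rV[R]_k -> 'rV[R]_n,
        forall u, U u -> forall xi, 'd f u xi = amul A (f' u) ('d phi u xi)].

Definition A_differentiable (R : realType) (n : nat) (A : algebraOn R n)
    (Omega : set 'rV[R]_n) (F : 'rV[R]_n -> 'rV[R]_n) : Prop :=
  phiA_differentiable A id Omega F.

(* The condition w @` V `<=` Omega is what makes F (w tau) meaningful, F being
   given on Omega only. *)
Definition phiA_solution (R : realType) (k n : nat) (A : algebraOn R n)
    (phi : 'rV[R]_k -> 'rV[R]_n) (Omega : set 'rV[R]_n)
    (F : 'rV[R]_n -> 'rV[R]_n) (tau0 : 'rV[R]_k) (w0 : 'rV[R]_n)
    (V : set 'rV[R]_k) (w : 'rV[R]_k -> 'rV[R]_n) : Prop :=
  [/\ phiA_differentiable A phi V w,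
      w @` V `<=` Omega,
      w tau0 = w0 &
      forall tau, V tau -> forall xi,
        'd w tau xi = amul A (F (w tau)) ('d phi tau xi)].

(* Main.v *)
Require Import Defs.
From HB Require Import structures.
From mathcomp Require Import all_boot all_order all_algebra.
From mathcomp Require Import all_classical all_reals all_analysis.
From mathcomp Require Import ring lra.

Set Implicit Arguments.
Unset Strict Implicit.
Unset Printing Implicit Defensive.

Import Order.TTheory GRing.Theory Num.Theory.
Import numFieldNormedType.Exports.

Local Open Scope classical_set_scope.
Local Open Scope ring_scope.

(** F need not be C^1, so Picard iteration is not available; the equation is
    integrated by a primitive instead.  Put a = F(w0).  Any solution stays in
    the coset w0 + aA: modulo the ideal aA, F vanishes at w0 and is
    differentiable there, so the defect satisfies a homogeneous linear
    differential inequality.  Writing w = w0 + a y, one has F(w0 + a y) = a u(y)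
    with u(0) = e, hence u(y) is a unit for small y even though a itself may be
    a zero divisor.  The function a u(y)^-1 is A-differentiable in y, so it has
    a primitive P by Goursat's triangle subdivision, which works in every
    commutative algebra since it only needs pointwise differentiability.  The
    differential equation becomes P(y) = a (phi - phi(tau0)), and P is
    invertible near 0 up to the annihilator of a. *)

(** * Differentials and the mean value inequality *)

(** It suffices to solve the case where [phi] is the identity: if [W] is a Lorch solution near
    [phi tau0] with value [w0] there, the chain rule makes [W \o phi] a solution. Since [a] may be a
    zero divisor, the coordinate [y] of a point of [w0 + aA] is determined only modulo the
    annihilator of [a]; the linear map [adiv], a generalized inverse of multiplication by [a], picks
    one representative, and the projection [acoker] tests membership in [aA]. The inequality that
    confines solutions to the coset uses the size of [F'] at the single point [w0]: modulo [aA], [F]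
    is locally constant along [aA], so a displacement can first be replaced by its image under
    [acoker]. All of this is local at one point; uniqueness on a ball follows by restarting the
    argument at points of a segment from the centre, with the common value there as new [w0]. *)

Section Differentials.
Variable R : realType.

Lemma coord_norm_le n (x : 'rV[R]_n) i : `|x 0 i| <= `|x|.
Proof.
by rewrite [leRHS]/Num.Def.normr/= mx_normrE (le_bigmax _ _ (0, i)).
Qed.

Lemma norm_le_coord n (x : 'rV[R]_n) M :
  0 <= M -> (forall i, `|x 0 i| <= M) -> `|x| <= M.
Proof.
move=> M0 xM; rewrite [leLHS]/Num.Def.normr/= mx_normrE.
by apply: bigmax_le => // -[i j] _; rewrite (ord1 i).
Qed.

Lemma norm_linear_le_basis m n (f : {linear 'rV[R]_m -> 'rV[R]_n}) x :
  `|f x| <= (\sum_j `|f (delta_mx 0 j)|) * `|x|.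
Proof.
rewrite [in leLHS](row_sum_delta x) linear_sum mulr_suml.
apply: (le_trans (ler_norm_sum _ _ _)); apply: ler_sum => j _.
by rewrite linearZ normrZ mulrC ler_wpM2l// coord_norm_le.
Qed.

Lemma rV_linear_bounded m n (f : {linear 'rV[R]_m -> 'rV[R]_n}) :
  exists2 C, 0 < C & forall x, `|f x| <= C * `|x|.
Proof.
exists (1 + \sum_j `|f (delta_mx 0 j)|).
  by rewrite ltr_pwDl// sumr_ge0.
by move=> x; rewrite mulrDl mul1r ler_wpDl// norm_linear_le_basis.
Qed.

Lemma rV_linear_continuous m n (f : {linear 'rV[R]_m -> 'rV[R]_n}) :
  continuous f.
Proof.
have [C C0 fC] := rV_linear_bounded f.
apply: bounded_linear_continuous; apply/bounded_funP => r.
by exists (C * r) => x xr; rewrite (le_trans (fC x))// ler_wpM2l// ltW.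
Qed.

Variables V W : normedModType R.

Lemma differentiable_norm_le (f : V -> W) (x : V) : differentiable f x ->
  forall e, 0 < e -> exists2 d, 0 < d &
    forall h, `|h| < d -> `|f (x + h) - f x - 'd f x h| <= e * `|h|.
Proof.
move=> /diff_locally /eqaddoP fx e /fx /nbhs_ballP[d /= d0 dfx].
exists d => // h hd; have := dfx h.
rewrite -ball_normE /= sub0r normrN => /(_ hd).
by rewrite /= !fctE /= [h + x]addrC opprD addrA.
Qed.

(** The tool for differentials found by hand (quadratic maps, primitives, inverses, the solution
    itself): a first-order expansion with a continuous linear part also identifies ['d f x]. *)
Lemma norm_le_differentiable (f : V -> W) (x : V) (L : {linear V -> W}) :
  continuous L ->
  (forall e, 0 < e -> exists2 d, 0 < d &
    forall h, `|h| < d -> `|f (x + h) - f x - L h| <= e * `|h|) ->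
  differentiable f x /\ 'd f x = L :> (V -> W).
Proof.
move=> cL fL.
have fo : f \o shift x = cst (f x) + L +o_ 0 id.
  apply/eqaddoP => e /fL[d d0 dfx]; apply/nbhs_ballP; exists d => //= h.
  rewrite -ball_normE /= sub0r normrN => /dfx.
  by rewrite /= !fctE /= [h + x]addrC opprD addrA.
have dfE := diff_unique cL fo.
by split=> //; apply/diff_locallyP; rewrite dfE.
Qed.

End Differentials.

Section Composition.
Variables (R : realType) (V : normedModType R).

Lemma diff_comp_apply (W W' : normedModType R) (f : V -> W) (g : W -> W') x :
  differentiable f x -> differentiable g (f x) ->
  forall h, 'd (g \o f) x h = 'd g (f x) ('d f x h).
Proof. by move=> df dg h; exact: (congr1 (@^~ h) (diff_comp df dg)). Qed.

Lemma diff_linear_comp m n (f : V -> 'rV[R]_m) (L : {linear 'rV[R]_m -> 'rV[R]_n})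
    x : differentiable f x ->
  differentiable (L \o f) x /\ forall h, 'd (L \o f) x h = L ('d f x h).
Proof.
move=> df; have cL := @rV_linear_continuous R m n L.
have dL y : differentiable L y by exact: linear_differentiable.
split=> [|h]; first exact: differentiable_comp.
apply: etrans (diff_comp_apply df (dL _) h) _.
exact: (congr1 (@^~ ('d f x h)) (diff_lin (f x) cL)).
Qed.

End Composition.

Section MeanValue.
Variables (R : realType) (V : normedModType R).

Lemma is_derive_line (W : normedModType R) (f : V -> W) (p v : V) (t : R) :
  differentiable f (p + t *: v) ->
  is_derive t 1 (fun s : R => f (p + s *: v)) ('d f (p + t *: v) v).
Proof.
move=> dft.
(* The difference quotient of the line map at [t] is the quotient of [f] at [p + t *: v] in the
   direction [v]. *)
have E : (fun h : R => h^-1 *: (f (p + (h *: (1 : R) + t) *: v) - f (p + t *: v)))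
    = (fun h : R => h^-1 *: (f (h *: v + (p + t *: v)) - f (p + t *: v))).
  by apply/funext => h; rewrite [h *: 1]mulr1 scalerDl addrCA.
apply: DeriveDef.
  by have := @diff_derivable _ _ _ _ _ v dft; rewrite /derivable /= E.
by rewrite -deriveE// /derive /= E.
Qed.

Lemma is_derive_coord n (g : R -> 'rV[R]_n) (t : R) dg i :
  is_derive t 1 g dg -> is_derive t 1 (fun s => g s 0 i) (dg 0 i).
Proof.
move=> [gt <-]; apply: DeriveDef; first by move/derivable_mxP : gt; apply.
by rewrite derive_mx// mxE.
Qed.

(** The norm is the maximum norm, so the scalar mean value theorem can be applied to each coordinate
    separately, with an intermediate point that depends on the coordinate. *)
Lemma mean_value_path n (g dg : R -> 'rV[R]_n) M :
  (forall t : R, 0 <= t <= 1 -> is_derive t 1 g (dg t)) ->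
  (forall t : R, 0 <= t <= 1 -> `|dg t| <= M) ->
  `|g 1 - g 0| <= M.
Proof.
move=> gdg dgM.
have M0 : 0 <= M by apply: (le_trans _ (dgM 0 _)); rewrite ?lexx ?ler01.
apply: norm_le_coord => // i; rewrite !mxE.
have dgi (t : R) : 0 <= t <= 1 -> is_derive t 1 (fun s => g s 0 i) (dg t 0 i).
  by move=> /gdg; apply: is_derive_coord.
have [|||c c01 ->] := @MVT_segment R (fun s => g s 0 i) (fun s => dg s 0 i) 0 1.
- exact: ler01.
- move=> x; rewrite in_itv /= => /andP[x0 x1]; apply: dgi.
  by rewrite !ltW.
- apply: derivable_within_continuous => x; rewrite in_itv /= => x01.
  by have [] := dgi x x01.
rewrite subr0 mulr1 (le_trans (coord_norm_le _ _))// dgM//.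
Qed.

Lemma mean_value_segment n (f : V -> 'rV[R]_n) (p q : V) M :
  (forall t : R, 0 <= t <= 1 -> differentiable f (p + t *: (q - p))) ->
  (forall t : R, 0 <= t <= 1 -> `|'d f (p + t *: (q - p)) (q - p)| <= M) ->
  `|f q - f p| <= M.
Proof.
move=> df dfM.
have := @mean_value_path _ (fun s => f (p + s *: (q - p)))
  (fun s => 'd f (p + s *: (q - p)) (q - p)) M.
rewrite /= scale1r scale0r addr0 [p + _]addrC subrK; apply => // t t01.
exact/is_derive_line/df.
Qed.

End MeanValue.

(** * The product of the algebra *)

Section AlgebraTheory.
Variables (R : realType) (n : nat) (A : algebraOn R n).
Local Notation "x ** y" := (amul A x y) (at level 40, left associativity).

Lemma amul_is_linear c : linear (amul A c).
Proof. by have [_ H] := amul_bilinear A; move=> k x y; apply: H. Qed.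

HB.instance Definition _ c :=
  GRing.isLinear.Build R 'rV[R]_n 'rV[R]_n _ (amul A c) (amul_is_linear c).

Lemma amulDr x y z : x ** (y + z) = x ** y + x ** z.
Proof. exact: linearD. Qed.

Lemma amulBr x y z : x ** (y - z) = x ** y - x ** z.
Proof. exact: linearB. Qed.

Lemma amulZr k x y : x ** (k *: y) = k *: (x ** y).
Proof. exact: linearZ. Qed.

Lemma amulr0 x : x ** 0 = 0.
Proof. exact: linear0. Qed.

Lemma amulDl x y z : (x + y) ** z = x ** z + y ** z.
Proof. by rewrite -!(amulC A z) amulDr. Qed.

Lemma amulBl x y z : (x - y) ** z = x ** z - y ** z.
Proof. by rewrite -!(amulC A z) amulBr. Qed.

Lemma amul0l x : 0 ** x = 0.
Proof. by rewrite amulC amulr0. Qed.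

Lemma amulr1 x : x ** aunit A = x.
Proof. by rewrite amulC amul1. Qed.

Lemma amulAC x y z : x ** y ** z = x ** z ** y.
Proof. by rewrite -!amulA (amulC A y). Qed.

Lemma amulCA x y z : x ** (y ** z) = y ** (x ** z).
Proof. by rewrite !amulA (amulC A x). Qed.

Lemma amul_bounded : exists2 M, 0 < M & forall x y, `|x ** y| <= M * `|x| * `|y|.
Proof.
have /choice[C HC] : forall j : 'I_n, exists C, 0 < C /\
    forall y, `|amul A (delta_mx 0 j) y| <= C * `|y|.
  by move=> j; have [C] := rV_linear_bounded (amul A (delta_mx 0 j)); exists C.
exists (1 + \sum_j C j).
  by rewrite ltr_pwDl// sumr_ge0// => j _; have [/ltW] := HC j.
move=> x y; rewrite !mulrDl mul1r ler_wpDl ?mulr_ge0//.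
rewrite [in leLHS](row_sum_delta x) amulC linear_sum !mulr_suml.
apply: (le_trans (ler_norm_sum _ _ _)); apply: ler_sum => j _.
have [Cj0 Cj] := HC j.
rewrite linearZ normrZ mulrAC mulrC ler_pM// ?coord_norm_le//.
by rewrite /= amulC.
Qed.

End AlgebraTheory.

(** * Integrals along segments *)

Section SegmentIntegral.
Variable R : realType.

Lemma antiderivative n (g : R -> 'rV[R]_n) : continuous g ->
  exists G : R -> 'rV[R]_n, forall t : R, 0 <= t <= 1 -> is_derive t 1 G (g t).
Proof.
move=> cg.
(* The base point -1 and the right end 2 used below put [0, 1] in the interior, so the derivative is
   two-sided at 0 and 1 as well. *)
pose G i t : R := (\int[lebesgue_measure]_(s in `[(- 1)%R, t]) (g s 0 i))%R.
have cgi i : continuous (fun s => g s 0 i).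
  by move=> s; apply: (@continuous_comp _ _ _ g (fun x => x 0 i)); 
    [exact: cg|exact: coord_continuous].
have dG i (t : R) : 0 <= t <= 1 -> derivable (G i) t 1 /\ derive1 (G i) t = g t 0 i.
  move=> /andP[t0 t1].
  apply: (@continuous_FTC1_closed R _ (-1) t 2).
  - by rewrite (le_lt_trans t1)// ltr1n.
  - apply: continuous_compact_integrable; first exact: segment_compact.
    exact: continuous_subspaceT.
  - by rewrite (lt_le_trans _ t0)// ltrN10.
  - exact: cgi.
pose H t : 'rV[R]_n := \row_i G i t.
have Hd (t : R) : 0 <= t <= 1 -> derivable H t 1.
  move=> t01; apply/derivable_mxP => i j.
  rewrite (_ : (fun x => H x i j) = G j); first by have [] := dG j t t01.
  by apply/funext => x; rewrite mxE.
exists H => t t01; apply: DeriveDef; first exact: Hd.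
rewrite derive_mx; last exact: Hd.
apply/rowP => j; rewrite mxE -derive1E.
rewrite (_ : (fun x => H x 0 j) = G j); first by have [] := dG j t t01.
by apply/funext => x; rewrite mxE.
Qed.

End SegmentIntegral.

Section SegmentGeometry.
Variables (R : realType) (V : normedModType R).
Implicit Types p q s : V.

Lemma norm_segment_lt p q (t r : R) : 0 <= t <= 1 ->
  `|p| < r -> `|q| < r -> `|p + t *: (q - p)| < r.
Proof.
move=> /andP[t0 t1] pr qr.
have -> : p + t *: (q - p) = (1 - t) *: p + t *: q.
  by rewrite scalerBr scalerBl scale1r [t *: q - _]addrC addrA.
rewrite (le_lt_trans (ler_normD _ _))// !normrZ !ger0_norm ?subr_ge0//.
have [->|tn0] := eqVneq t 0; first by rewrite subr0 mul1r mul0r addr0.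
have tp : 0 < t by rewrite lt_def tn0.
have : (1 - t) * `|p| <= (1 - t) * r by rewrite ler_wpM2l ?subr_ge0// ltW.
have : t * `|q| < t * r by rewrite ltr_pM2l.
lra.
Qed.

Lemma norm_segment_le p q (t r : R) : 0 <= t <= 1 ->
  `|p| <= r -> `|q| <= r -> `|p + t *: (q - p)| <= r.
Proof.
move=> t01 pr qr; apply/ler_addgt0Pr => e e0; apply/ltW.
by apply: norm_segment_lt => //; rewrite ltr_pwDr.
Qed.

Definition midpoint p q := p + 2^-1 *: (q - p).

Lemma midpoint_subl p q : midpoint p q - p = 2^-1 *: (q - p).
Proof. by rewrite /midpoint addrC addKr. Qed.

Lemma midpointC p q : midpoint p q = midpoint q p.
Proof.
rewrite /midpoint !scalerBr.
have E (x : V) : x = 2^-1 *: x + 2^-1 *: x.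
  by rewrite -scalerDl (_ : 2^-1 + 2^-1 = 1 :> R) ?scale1r//; field.
rewrite [X in X + (_ - _) = _](E p) [X in _ = X + _](E q).
by rewrite addrACA subrr addr0 [RHS]addrACA subrr addr0 addrC.
Qed.

Lemma midpoint_subm p q s : midpoint p q - midpoint p s = 2^-1 *: (q - s).
Proof. by rewrite /midpoint opprD addrACA subrr add0r -scalerBr opprB addrA subrK. Qed.

End SegmentGeometry.

Lemma half_itv (R : realType) : 0 <= (2^-1 : R) <= 1.
Proof. by rewrite invr_ge0 ler0n invf_le1 ?ltr0n// ler1n. Qed.

Section SegmentIntegrals.
Variables (R : realType) (n : nat) (A : algebraOn R n).
Local Notation "x ** y" := (amul A x y) (at level 40, left associativity).

(** The integral of K(z) dz along the segment, encoded by an antiderivative of the pulled-back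
    integrand: estimates, subdivision and uniqueness then all reduce to the mean value
    inequality. *)
Definition segment_integral (K : 'rV[R]_n -> 'rV[R]_n) (p q j : 'rV[R]_n) :=
  exists G : R -> 'rV[R]_n,
    (forall t : R, 0 <= t <= 1 ->
       is_derive t 1 G (K (p + t *: (q - p)) ** (q - p))) /\
    j = G 1 - G 0.

Lemma segment_integral_exists (K : 'rV[R]_n -> 'rV[R]_n) p q :
  (forall t : R, 0 <= t <= 1 -> {for p + t *: (q - p), continuous K}) ->
  exists j, segment_integral K p q j.
Proof.
move=> cK.
(* [clamp] retracts R onto [0, 1], where alone K is known to be continuous. *)
pose clamp (t : R) := 2^-1 * (`|t| - `|t - 1| + 1).
have clamp_id (t : R) : 0 <= t <= 1 -> clamp t = t.
  move=> /andP[t0 t1]; rewrite /clamp ger0_norm// ler0_norm ?subr_le0//; lra.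
have clamp01 (t : R) : 0 <= clamp t <= 1.
  rewrite /clamp; case: (ger0P t) => t0; case: (ger0P (t - 1)) => t1;
    apply/andP; split; lra.
have clampc : continuous clamp.
  move=> t; apply: cvgMr; apply: cvgD; last exact: cvg_cst.
  apply: cvgB; first exact: norm_continuous.
  apply: cvg_norm; apply: cvgB; [exact: cvg_id|exact: cvg_cst].
have [|G dG] := @antiderivative R n (fun t => (q - p) ** K (p + clamp t *: (q - p))).
  move=> t; apply: (@continuous_comp _ _ _ (fun t => K (p + clamp t *: (q - p)))).
    apply: (@continuous_comp _ _ _ (fun t => p + clamp t *: (q - p))).
      by apply: cvgD; [exact: cvg_cst|apply: cvgZr_tmp; exact: clampc].
    exact: cK.
  exact: rV_linear_continuous.
exists (G 1 - G 0); exists G; split=> // t t01.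
by have := dG t t01; rewrite clamp_id// amulC.
Qed.

End SegmentIntegrals.

Section SegmentIntegralTheory.
Variables (R : realType) (n : nat) (A : algebraOn R n).
Local Notation "x ** y" := (amul A x y) (at level 40, left associativity).
Implicit Types (K k E : 'rV[R]_n -> 'rV[R]_n) (p q j : 'rV[R]_n).

(** Subtracting from the antiderivative [G] the restriction of [E] to the segment leaves the
    derivative [(K - k) ** (q - p)]. The comparison field [k] is affine in the triangle estimate and
    constant when the primitive is differentiated. *)
Lemma segment_integral_near K k E p q j M eps :
  segment_integral A K p q j ->
  (forall x y, `|x ** y| <= M * `|x| * `|y|) -> 0 <= M ->
  (forall t : R, 0 <= t <= 1 -> differentiable E (p + t *: (q - p)) /\
     'd E (p + t *: (q - p)) (q - p) = k (p + t *: (q - p)) ** (q - p)) ->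
  (forall t : R, 0 <= t <= 1 ->
     `|K (p + t *: (q - p)) - k (p + t *: (q - p))| <= eps) ->
  `|j - (E q - E p)| <= M * eps * `|q - p|.
Proof.
move=> [G [dG ->]] AM M0 dE Kk.
have := @mean_value_path R n (fun t => G t - E (p + t *: (q - p)))
  (fun t => (K (p + t *: (q - p)) - k (p + t *: (q - p))) ** (q - p))
  (M * eps * `|q - p|).
rewrite /= scale1r scale0r addr0 [p + (q - p)]addrC subrK.
have -> : G 1 - E q - (G 0 - E p) = G 1 - G 0 - (E q - E p).
  by apply/rowP => i; rewrite !mxE; ring.
apply=> t t01.
  have [dEt dEE] := dE t t01; have dGt := dG t t01.
  have := is_derive_line dEt; rewrite dEE => dEl.
  by rewrite amulBl; exact: is_deriveB.
by rewrite (le_trans (AM _ _))// ler_wpM2r// ler_wpM2l// Kk.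
Qed.

(** One antiderivative, reparametrised, serves all subsegments in both orientations, so additivity
    and change of sign become identities between values of the same [G]. *)
Lemma segment_integral_sub K p q (G : R -> 'rV[R]_n) (s1 s2 : R) :
  0 <= s1 <= 1 -> 0 <= s2 <= 1 ->
  (forall t : R, 0 <= t <= 1 ->
     is_derive t 1 G (K (p + t *: (q - p)) ** (q - p))) ->
  segment_integral A K (p + s1 *: (q - p)) (p + s2 *: (q - p)) (G s2 - G s1).
Proof.
move=> s101 s201 dG; exists (fun t => G (s1 + t *: (s2 - s1))).
split; last by rewrite scale1r scale0r addr0 [s1 + _]addrC subrK.
move=> t t01.
have s01 : 0 <= s1 + t *: (s2 - s1) <= 1.
  have -> : s1 + t *: (s2 - s1) = (1 - t) * s1 + t * s2.
    by rewrite /GRing.scale /=; ring.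
  move: t01 s101 s201 => /andP[t0 t1] /andP[s10 s11] /andP[s20 s21].
  have t1' : 0 <= 1 - t by rewrite subr_ge0.
  apply/andP; split; first by rewrite addr_ge0// mulr_ge0.
  rewrite [leRHS](_ : 1 = (1 - t) * 1 + t * 1); last by ring.
  by rewrite lerD// ler_wpM2l.
have [dGs dGE] := dG _ s01.
have dGd : differentiable G (s1 + t *: (s2 - s1)) by exact/derivable1_diffP.
have := is_derive_line dGd.
have -> : 'd G (s1 + t *: (s2 - s1)) (s2 - s1) =
    (s2 - s1) *: 'D_1 G (s1 + t *: (s2 - s1)).
  by rewrite (deriveE _ dGd) -linearZ; congr ('d G _ _); rewrite [RHS]mulr1.
rewrite dGE.
suff -> : K (p + s1 *: (q - p) + t *: (p + s2 *: (q - p) - (p + s1 *: (q - p)))) **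
    (p + s2 *: (q - p) - (p + s1 *: (q - p))) =
  (s2 - s1) *: (K (p + (s1 + t *: (s2 - s1)) *: (q - p)) ** (q - p)) by [].
have -> : p + s2 *: (q - p) - (p + s1 *: (q - p)) = (s2 - s1) *: (q - p).
  by apply/rowP => i; rewrite !mxE; ring.
rewrite amulZr; congr (_ *: (K _ ** _)).
by rewrite /GRing.scale/=; apply/rowP => i; rewrite !mxE; ring.
Qed.

End SegmentIntegralTheory.

(** * Goursat's theorem *)

Section Sequences.
Variable R : realType.

Lemma half_expS (d : R) k : d / 2 ^+ k.+1 = 2^-1 * (d / 2 ^+ k).
Proof. by rewrite exprS; field; rewrite ?expf_neq0 ?pnatr_eq0. Qed.

Lemma exists_half_exp_lt (d e : R) : 0 < e -> exists k, d / 2 ^+ k < e.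
Proof.
move=> e0; exists (Num.truncn (`|d| / e)).+1.
have := truncnS_gt (`|d| / e); set k := _.+1 => dk.
have k2 : k%:R <= 2 ^+ k :> R by rewrite -natrX ler_nat ltnW// ltn_expl.
rewrite ltr_pdivrMr ?exprn_gt0//; rewrite ltr_pdivrMr// in dk.
rewrite (le_lt_trans (ler_norm d))// (lt_le_trans dk)// mulrC ler_wpM2l//.
exact: ltW.
Qed.

(** In each coordinate the intervals of radius [2 * (d / 2 ^+ k)] around [u k] are nested, because
    this radius is a step [d / 2 ^+ k] plus the next radius. The supremum of the left ends lies in
    all of them. *)
Lemma geometric_steps_limit n (u : nat -> 'rV[R]_n) (d : R) :
  (forall k, `|u k.+1 - u k| <= d / 2 ^+ k) ->
  exists l, forall k, `|u k - l| <= 2 * (d / 2 ^+ k).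
Proof.
move=> ud.
have d0 k : 0 <= d / 2 ^+ k by exact: le_trans (ud k).
pose lo i k := u k 0 i - 2 * (d / 2 ^+ k).
pose hi i k := u k 0 i + 2 * (d / 2 ^+ k).
have udi i k : u k 0 i - d / 2 ^+ k <= u k.+1 0 i <= u k 0 i + d / 2 ^+ k.
  have := coord_norm_le (u k.+1 - u k) i; rewrite !mxE => /le_trans/(_ (ud k)).
  by rewrite ler_distl.
have loS i k : lo i k <= lo i k.+1.
  rewrite /lo half_expS; have /andP[h _] := udi i k; lra.
have hiS i k : hi i k.+1 <= hi i k.
  rewrite /hi half_expS; have /andP[_ h] := udi i k; lra.
have lohom i : {homo lo i : k m / (k <= m)%N >-> k <= m}.
  by apply: homo_leq => //; exact: le_trans.
have hihom i : {homo hi i : k m / (k <= m)%N >-> m <= k}.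
  by apply: homo_leq => // x y z yx zy; exact: le_trans zy yx.
have lohi i k m : lo i k <= hi i m.
  apply: (le_trans (lohom i k (maxn k m) (leq_maxl _ _))).
  apply: (le_trans _ (hihom i m (maxn k m) (leq_maxr _ _))).
  by rewrite /lo /hi; have := d0 (maxn k m); lra.
exists (\row_i sup (range (lo i))) => k.
apply: norm_le_coord => [|i]; first by rewrite mulr_ge0.
rewrite !mxE ler_distlC; apply/andP; split.
  apply: ub_le_sup; last by exists k.
  by exists (hi i 0%N) => _ [m _ <-]; exact: lohi.
apply: ge_sup; first by exists (lo i 0%N); exists 0%N.
by move=> _ [m _ <-]; exact: lohi.
Qed.

End Sequences.

Section Lorch.
Variables (R : realType) (n : nat) (A : algebraOn R n).
Local Notation "x ** y" := (amul A x y) (at level 40, left associativity).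

Lemma A_differentiableP (D : set 'rV[R]_n) (K : 'rV[R]_n -> 'rV[R]_n) :
  A_differentiable A D K <->
  exists K' : 'rV[R]_n -> 'rV[R]_n, forall z, D z ->
    differentiable K z /\ forall h, 'd K z h = K' z ** h.
Proof.
have did (z : 'rV[R]_n) : 'd id z = id :> ('rV[R]_n -> 'rV[R]_n) by exact: diff_val.
split=> [[_ dK [K' KE]]|[K' KE]].
  by exists K' => z Dz; split=> [|h]; [exact: dK|rewrite KE// did].
split=> [z _|z /KE[]//|]; first by have [] := is_diff_id z.
exists K' => z Dz h; have [_ E] := KE z Dz.
by apply: etrans (E h) _; congr (_ ** _); rewrite did.
Qed.

(** A primitive of an affine field, for comparison with [K] on small triangles. Commutativity makes
    the remainder exactly half of [c ** h ** h]. *)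
Lemma differentiable_quadratic (a c z : 'rV[R]_n) :
  let E z := a ** z + 2^-1 *: (c ** z ** z) in
  differentiable E z /\ forall h, 'd E z h = (a + c ** z) ** h.
Proof.
move=> E; have [M M0 AM] := amul_bounded A.
have [||dE EE] := @norm_le_differentiable R _ _ E z (amul A (a + c ** z)).
- exact: rV_linear_continuous.
- move=> e e0; have C0 : 0 < M * M * (`|c| + 1).
    by rewrite !mulr_gt0// ltr_wpDl.
  exists (e / (M * M * (`|c| + 1))); first by rewrite divr_gt0.
  move=> h; rewrite ltr_pdivlMr// => hd.
  have -> : E (z + h) - E z - (a + c ** z) ** h = 2^-1 *: (c ** h ** h).
    rewrite /E !(amulDr, amulDl) (amulAC A c h z).
    by apply/rowP => i; rewrite !mxE; field.
  rewrite normrZ ger0_norm ?invr_ge0//.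
  have h1 : `|c ** h ** h| <= M * (M * `|c| * `|h|) * `|h|.
    by rewrite (le_trans (AM _ _))// ler_wpM2r// ler_wpM2l ?AM// ltW.
  have h2 : M * (M * `|c| * `|h|) * `|h| <= e * `|h|.
    rewrite ler_wpM2r// (le_trans _ (ltW hd))//.
    rewrite (_ : M * _ = `|h| * (M * M * `|c|)); last by ring.
    by rewrite ler_wpM2l// ler_wpM2l ?lerDl// mulr_ge0// ltW.
  apply: (le_trans _ (le_trans h1 h2)).
  by rewrite ler_piMl// invf_le1// ler1n.
by split=> // h; rewrite EE.
Qed.

End Lorch.

Section TriangleSubdivision.
Variables (R : realType) (n : nat) (A : algebraOn R n).
Local Notation "x ** y" := (amul A x y) (at level 40, left associativity).

Variables (K : 'rV[R]_n -> 'rV[R]_n) (r : R).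
Implicit Types p q s x y z c h : 'rV[R]_n.
Hypothesis KA : A_differentiable A [set z | `|z| < r] K.
Variable T : 'rV[R]_n -> 'rV[R]_n -> 'rV[R]_n -> 'rV[R]_n.
Hypothesis T_medial : forall p q s, `|p| < r -> `|q| < r -> `|s| < r ->
  `|T p q s| <= `|T p (midpoint p q) (midpoint s p)| +
                `|T (midpoint p q) q (midpoint q s)| +
                `|T (midpoint s p) (midpoint q s) s| +
                `|T (midpoint p q) (midpoint q s) (midpoint s p)|.
Hypothesis T_affine : forall M eta z0 c p q s,
  (forall x y, `|x ** y| <= M * `|x| * `|y|) -> 0 <= M ->
  `|p| < r -> `|q| < r -> `|s| < r ->
  (forall x y (t : R), x \in [:: p; q; s] -> y \in [:: p; q; s] -> 0 <= t <= 1 ->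
    `|K (x + t *: (y - x)) - (K z0 + c ** (x + t *: (y - x) - z0))| <= eta) ->
  `|T p q s| <= M * eta * (`|q - p| + `|s - q| + `|p - s|).

Let small p q s (d : R) := [/\ `|q - p| <= d, `|s - q| <= d & `|p - s| <= d].

Let T_step rho p q s d : rho < r ->
  `|p| <= rho -> `|q| <= rho -> `|s| <= rho -> small p q s d ->
  exists x : 'rV[R]_n * 'rV[R]_n * 'rV[R]_n,
    [/\ [/\ `|x.1.1| <= rho, `|x.1.2| <= rho & `|x.2| <= rho],
      small x.1.1 x.1.2 x.2 (2^-1 * d), `|x.1.1 - p| <= d &
      `|T p q s| <= 4 * `|T x.1.1 x.1.2 x.2| ].
Proof.
move=> rhor prho qrho srho [qp sq ps].
have [pr qr sr] : [/\ `|p| < r, `|q| < r & `|s| < r].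
  by split; apply: le_lt_trans rhor.
have mrho x y : `|x| <= rho -> `|y| <= rho -> `|midpoint x y| <= rho.
  by move=> xr yr; apply: norm_segment_le; rewrite ?half_itv.
have h0 : 0 <= 2^-1 :> R by rewrite invr_ge0.
have d0 : 0 <= d by exact: le_trans qp.
have hd : 2^-1 * d <= d by rewrite ler_piMl// invf_le1// ler1n.
have half x y : `|x - y| <= d -> `|2^-1 *: (x - y)| <= 2^-1 * d.
  by move=> xy; rewrite normrZ ger0_norm// ler_wpM2l.
have pq : `|p - q| <= d by rewrite distrC.
have qs : `|q - s| <= d by rewrite distrC.
have sp : `|s - p| <= d by rewrite distrC.
set m1 := midpoint p q; set m2 := midpoint q s; set m3 := midpoint s p.
have m1p : `|m1 - p| <= 2^-1 * d by rewrite midpoint_subl half.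
have m3p : `|m3 - p| <= 2^-1 * d by rewrite /m3 midpointC midpoint_subl half.
have m1q : `|m1 - q| <= 2^-1 * d by rewrite /m1 midpointC midpoint_subl half.
have m2q : `|m2 - q| <= 2^-1 * d by rewrite midpoint_subl half.
have m2s : `|m2 - s| <= 2^-1 * d by rewrite /m2 midpointC midpoint_subl half.
have m3s : `|m3 - s| <= 2^-1 * d by rewrite midpoint_subl half.
have m12 : `|m1 - m2| <= 2^-1 * d by rewrite /m1 midpointC midpoint_subm half.
have m23 : `|m2 - m3| <= 2^-1 * d by rewrite /m2 midpointC midpoint_subm half.
have m31 : `|m3 - m1| <= 2^-1 * d by rewrite /m3 midpointC midpoint_subm half.
have := T_medial pr qr sr; rewrite -/m1 -/m2 -/m3 => Tle.
have mrhos : [/\ `|m1| <= rho, `|m2| <= rho & `|m3| <= rho] by split; exact: mrho.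
case: mrhos => m1rho m2rho m3rho; clearbody m1 m2 m3.
have [|H1] := lerP `|T p q s| (4 * `|T p m1 m3|).
  exists (p, m1, m3); split=> //=.
    by split=> //; rewrite distrC.
  by rewrite subrr normr0.
have [|H2] := lerP `|T p q s| (4 * `|T m1 q m2|).
  exists (m1, q, m2); split=> //=.
    by split=> //; rewrite distrC.
  exact: le_trans hd.
have [|H3] := lerP `|T p q s| (4 * `|T m3 m2 s|).
  exists (m3, m2, s); split=> //=.
    by split=> //; rewrite distrC.
  exact: le_trans hd.
(* The three corner triangles each carry less than a quarter of [T p q s], so the central one
   carries more. *)
exists (m1, m2, m3); split=> //=.
- by split; rewrite distrC.
- exact: le_trans hd.
- move: Tle H1 H2 H3; clear; move: `|T p q s| `|T p m1 m3| `|T m1 q m2|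
    `|T m3 m2 s| `|T m1 m2 m3| => a b c d' e; lra.
Qed.

(** Each subdivision keeps at least a quarter of [T] and halves the bound on the sides, while the
    first vertices converge to a point [z0]. Differentiability of [K] at [z0] makes [T] on the k-th
    triangle at most a small multiple of the square of its size, which beats the factor [4 ^+ k].
    Keeping [T] abstract isolates the two properties of a contour integral that this needs. *)
Lemma triangle_vanishes p q s : `|p| < r -> `|q| < r -> `|s| < r -> T p q s = 0.
Proof.
move=> pr qr sr; have [M M_gt0 AM] := amul_bounded A.
pose rho := Num.max `|p| (Num.max `|q| `|s|).
have rhor : rho < r by rewrite !gt_max pr qr sr.
have [prho qrho srho] : [/\ `|p| <= rho, `|q| <= rho & `|s| <= rho].
  by rewrite !le_max !lexx ?orbT.
pose d := Num.max `|q - p| (Num.max `|s - q| `|p - s|).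
have sd : small p q s d by split; rewrite !le_max !lexx ?orbT.
have d_ge0 : 0 <= d by rewrite le_max normr_ge0.
pose tri := ('rV[R]_n * 'rV[R]_n * 'rV[R]_n)%type.
pose inside (x : tri) := [/\ `|x.1.1| <= rho, `|x.1.2| <= rho & `|x.2| <= rho].
have /choice[f fP] (xe : tri * R) : exists y : tri,
    inside xe.1 -> small xe.1.1.1 xe.1.1.2 xe.1.2 xe.2 ->
    [/\ inside y, small y.1.1 y.1.2 y.2 (2^-1 * xe.2), `|y.1.1 - xe.1.1.1| <= xe.2 &
      `|T xe.1.1.1 xe.1.1.2 xe.1.2| <= 4 * `|T y.1.1 y.1.2 y.2| ].
  case: xe => [[[x1 x2] x3] e] /=.
  have [[[xr yr zr] sx]|nH] := pselect (inside (x1, x2, x3) /\ small x1 x2 x3 e).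
    by have [y yP] := T_step rhor xr yr zr sx; exists y.
  by exists (x1, x2, x3) => ix sx; case: nH.
pose u := fix u k := if k is j.+1 then f (u j, d / 2 ^+ j) else (p, q, s).
have uP k : [/\ inside (u k), small (u k).1.1 (u k).1.2 (u k).2 (d / 2 ^+ k) &
    `|T p q s| <= 4 ^+ k * `|T (u k).1.1 (u k).1.2 (u k).2| ].
  elim: k => [|k [uin usm uT]]; first by rewrite expr0 invr1 mulr1 mul1r.
  have [uin' usm' _ uT'] := fP (u k, d / 2 ^+ k) uin usm.
  split=> //; first by rewrite half_expS.
  by rewrite (le_trans uT)// exprSr -mulrA ler_wpM2l// exprn_ge0.
have ud k : `|(u k.+1).1.1 - (u k).1.1| <= d / 2 ^+ k.
  by have [uin usm _] := uP k; have [] := fP (u k, d / 2 ^+ k) uin usm.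
have [z0 uz0] := geometric_steps_limit (u := fun k => (u k).1.1) ud.
(* All vertices stay in the closed ball of radius [rho < r], hence so does their limit. *)
have z0r : `|z0| < r.
  apply: le_lt_trans rhor; apply/ler_addgt0Pr => e e0.
  have [k ke] := @exists_half_exp_lt R (2 * d) e e0.
  have [[uk _ _] _ _] := uP k.
  rewrite -[z0](subrK (u k).1.1) addrC (le_trans (ler_normD _ _))// lerD//.
  by rewrite distrC (le_trans (uz0 k))// mulrA ltW.
have [K' /(_ z0 z0r)] := (A_differentiableP _ _ _).1 KA.
set c := K' z0 => -[dK KE].
apply/normr0_eq0/eqP; rewrite eq_le normr_ge0 andbT.
apply/ler_addgt0Pr => e e0; rewrite add0r.
(* The 9 is 3 * 3: points of the k-th triangle lie within [3 * dk] of [z0], and its perimeter is at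
   most [3 * dk]. Using [d + 1] keeps the denominator positive when the triangle degenerates. *)
pose eps := e / (9 * M * (d + 1) ^+ 2).
have C_gt0 : 0 < 9 * M * (d + 1) ^+ 2 by rewrite !mulr_gt0// ltr_wpDl.
have eps_gt0 : 0 < eps by rewrite divr_gt0.
have [del del_gt0 Kdel] := differentiable_norm_le dK eps_gt0.
have [k kdel] := @exists_half_exp_lt R (3 * d) del del_gt0.
have [[x1r x2r x3r] [x21 x32 x13] Tk] := uP k.
have := uz0 k; set dk := d / 2 ^+ k in x21 x32 x13 * => x1z0.
have dk3 : 3 * dk < del by rewrite mulrA.
move: x1r x2r x3r x21 x32 x13 Tk x1z0.
case: (u k) => -[x1 x2] x3 /= x1r x2r x3r x21 x32 x13 Tk x1z0.
have near1 x : x \in [:: x1; x2; x3] -> `|x - x1| <= dk.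
  rewrite !inE => /or3P[] /eqP ->; rewrite // ?(distrC x3)// subrr normr0.
  by rewrite (le_trans _ x21).
have near0 x y (t : R) : x \in [:: x1; x2; x3] -> y \in [:: x1; x2; x3] ->
    0 <= t <= 1 -> `|x + t *: (y - x) - z0| <= 3 * dk.
  move=> xI yI t01.
  have -> : x + t *: (y - x) - z0 =
      ((x - x1) + t *: ((y - x1) - (x - x1))) + (x1 - z0).
    by apply/rowP => i; rewrite !mxE; ring.
  rewrite (le_trans (ler_normD _ _))// (_ : 3 * dk = dk + 2 * dk); last by ring.
  by rewrite lerD// norm_segment_le// near1.
have Tx : `|T x1 x2 x3| <= M * (eps * (3 * dk)) * (`|x2 - x1| + `|x3 - x2| + `|x1 - x3|).
  apply: (@T_affine M (eps * (3 * dk)) z0 c x1 x2 x3) => //.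
  - exact: ltW.
  - exact: le_lt_trans rhor.
  - exact: le_lt_trans rhor.
  - exact: le_lt_trans rhor.
  move=> x y t xI yI t01; have := near0 x y t xI yI t01.
  move: (x + t *: (y - x)) => z zz0.
  have := Kdel (z - z0) (le_lt_trans zz0 dk3).
  rewrite KE [z0 + _]addrC subrK opprD addrA => /le_trans; apply.
  by rewrite ler_wpM2l// ltW.
apply: (le_trans Tk).
have Tx' : `|T x1 x2 x3| <= M * (eps * (3 * dk)) * (3 * dk).
  apply: (le_trans Tx); rewrite ler_wpM2l//; last first.
    by rewrite (_ : 3 * dk = dk + dk + dk) ?lerD//; ring.
  have dk0 : 0 <= dk by exact: le_trans x21.
  by rewrite mulr_ge0 ?(ltW M_gt0)// mulr_ge0 ?(ltW eps_gt0)// mulr_ge0.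
apply: (@le_trans _ _ (4 ^+ k * (M * (eps * (3 * dk)) * (3 * dk)))).
  by rewrite ler_wpM2l// exprn_ge0.
have -> : 4 ^+ k * (M * (eps * (3 * dk)) * (3 * dk)) = 9 * M * d ^+ 2 * eps.
  rewrite /dk (_ : 4 = 2 * 2 :> R) ?exprMn; last by ring.
  by field; rewrite expf_neq0// pnatr_eq0.
rewrite -[leRHS](divfK (lt0r_neq0 C_gt0)) -/eps [leRHS]mulrC.
rewrite ler_wpM2r ?(ltW eps_gt0)// ler_wpM2l ?mulr_ge0 ?(ltW M_gt0)//.
by rewrite ler_sqr ?nnegrE ?addr_ge0// lerDl.
Qed.

End TriangleSubdivision.

Section Goursat.
Variables (R : realType) (n : nat) (A : algebraOn R n).
Local Notation "x ** y" := (amul A x y) (at level 40, left associativity).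

Variables (K : 'rV[R]_n -> 'rV[R]_n) (r : R).
Implicit Types p q s x y z c h : 'rV[R]_n.
Hypothesis KA : A_differentiable A [set z | `|z| < r] K.

Let K_continuous z : `|z| < r -> {for z, continuous K}.
Proof. by case: KA => _ dK _ /dK /differentiable_continuous. Qed.

Local Notation seg := (segment_integral A K).

(** For endpoints in the ball the integral exists and is unique, so the default value 0 is never the
    result of a failed choice there. *)
Let J p q := xget 0 (seg p q).

Let JP p q : `|p| < r -> `|q| < r -> seg p q (J p q).
Proof.
move=> pr qr; rewrite /J; case: xgetP => [j -> //|/forallNP []].
have [|j] := @segment_integral_exists R n A K p q; last by exists j.
by move=> t t01; apply/K_continuous/norm_segment_lt.
Qed.

Let seg_uniq p q j : `|p| < r -> `|q| < r -> seg p q j -> J p q = j.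
Proof.
move=> pr qr [G [dG ->]]; have [G' [dG' ->]] := JP pr qr.
apply/subr0_eq/normr0_eq0/eqP; rewrite eq_le normr_ge0 andbT.
have := @mean_value_path R n (fun t => G' t - G t) (fun t => 0) 0.
rewrite (_ : G' 1 - G' 0 - (G 1 - G 0) = G' 1 - G 1 - (G' 0 - G 0)).
  2: by apply/rowP => i; rewrite !mxE; ring.
apply=> t t01; last by rewrite normr0.
rewrite -(subrr (K (p + t *: (q - p)) ** (q - p))).
by have := dG t t01; have := dG' t t01; exact: is_deriveB.
Qed.

Let Jsub p q (s1 s2 s3 : R) : `|p| < r -> `|q| < r ->
  0 <= s1 <= 1 -> 0 <= s2 <= 1 -> 0 <= s3 <= 1 ->
  J (p + s1 *: (q - p)) (p + s2 *: (q - p)) +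
    J (p + s2 *: (q - p)) (p + s3 *: (q - p)) =
  J (p + s1 *: (q - p)) (p + s3 *: (q - p)).
Proof.
move=> pr qr s1P s2P s3P; pose L t := p + t *: (q - p).
have [G [dG _]] := JP pr qr.
have JG t1 t2 : 0 <= t1 <= 1 -> 0 <= t2 <= 1 -> J (L t1) (L t2) = G t2 - G t1.
  move=> t1P t2P; apply: seg_uniq; try exact: norm_segment_lt.
  exact: segment_integral_sub.
by rewrite -!/(L _) !JG// addrC addrA subrK.
Qed.

Let J_refl p : `|p| < r -> J p p = 0.
Proof.
move=> pr; have := @Jsub p p 0 0 0 pr pr.
rewrite lexx ler01 scale0r addr0 => /(_ isT isT isT) /eqP.
by rewrite -subr_eq0 addrK => /eqP.
Qed.

Let J_sym p q : `|p| < r -> `|q| < r -> J q p = - J p q.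
Proof.
move=> pr qr; have := @Jsub p q 0 1 0 pr qr.
rewrite !lexx !ler01 scale0r addr0 scale1r [p + _]addrC subrK J_refl//.
by move=> /(_ isT isT isT) /eqP; rewrite addr_eq0 => /eqP ->; rewrite opprK.
Qed.

Let J_mid p q : `|p| < r -> `|q| < r ->
  J p q = J p (midpoint p q) + J (midpoint p q) q.
Proof.
move=> pr qr; have := @Jsub p q 0 2^-1 1 pr qr.
rewrite !lexx !ler01 !half_itv scale0r addr0 scale1r [p + (q - p)]addrC subrK.
by move=> /(_ isT isT isT) <-.
Qed.

Let T p q s := J p q + J q s + J s p.

(** The outer half edges recombine into the three sides; each inner edge is traversed once in each
    direction and cancels. *)
Let T_medial p q s : `|p| < r -> `|q| < r -> `|s| < r ->
  T p q s = T p (midpoint p q) (midpoint s p) +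
            T (midpoint p q) q (midpoint q s) +
            T (midpoint s p) (midpoint q s) s +
            T (midpoint p q) (midpoint q s) (midpoint s p).
Proof.
move=> pr qr sr; rewrite /T.
have mr x y : `|x| < r -> `|y| < r -> `|midpoint x y| < r.
  by move=> xr yr; apply: norm_segment_lt; rewrite ?half_itv.
rewrite (J_mid pr qr) (J_mid qr sr) (J_mid sr pr).
rewrite (@J_sym (midpoint p q) (midpoint q s)) ?mr//.
rewrite (@J_sym (midpoint q s) (midpoint s p)) ?mr//.
rewrite (@J_sym (midpoint s p) (midpoint p q)) ?mr//.
move: (J p (midpoint p q)) (J (midpoint p q) q) (J q (midpoint q s))
  (J (midpoint q s) s) (J s (midpoint s p)) (J (midpoint s p) p)
  (J (midpoint p q) (midpoint q s)) (J (midpoint q s) (midpoint s p))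
  (J (midpoint s p) (midpoint p q)) => x1 x2 x3 x4 x5 x6 x7 x8 x9.
by apply/rowP => i; rewrite !mxE; ring.
Qed.

Let T_affine M eta z0 c p q s :
  (forall x y, `|x ** y| <= M * `|x| * `|y|) -> 0 <= M ->
  `|p| < r -> `|q| < r -> `|s| < r ->
  (forall x y (t : R), x \in [:: p; q; s] -> y \in [:: p; q; s] -> 0 <= t <= 1 ->
    `|K (x + t *: (y - x)) - (K z0 + c ** (x + t *: (y - x) - z0))| <= eta) ->
  `|T p q s| <= M * eta * (`|q - p| + `|s - q| + `|p - s|).
Proof.
move=> AM M0 pr qr sr Keta.
(* A primitive of [K z0 + c ** (z - z0)]: its increments around the triangle sum to zero, so only
   the deviation [eta] contributes. *)
pose E z := (K z0 - c ** z0) ** z + 2^-1 *: (c ** z ** z).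
have JE x y : `|x| < r -> `|y| < r -> x \in [:: p; q; s] -> y \in [:: p; q; s] ->
    `|J x y - (E y - E x)| <= M * eta * `|y - x|.
  move=> xr yr xI yI.
  apply: (@segment_integral_near _ _ A K (fun z => K z0 + c ** (z - z0)) E x y) => //.
  - exact: JP.
  - move=> t t01.
    have [dE EE] := differentiable_quadratic A (K z0 - c ** z0) c (x + t *: (y - x)).
    by split=> //; rewrite EE; congr (_ ** _); rewrite amulBr addrAC addrA.
  - by move=> t t01; exact: Keta.
have -> : T p q s = (J p q - (E q - E p)) + (J q s - (E s - E q)) +
    (J s p - (E p - E s)).
  rewrite /T; move: (E p) (E q) (E s) (J p q) (J q s) (J s p) => x1 x2 x3 x4 x5 x6.
  by apply/rowP => i; rewrite !mxE; ring.
rewrite !mulrDr (le_trans (ler_normD _ _))// lerD ?JE ?inE ?eqxx ?orbT//.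
by rewrite (le_trans (ler_normD _ _))// lerD// JE ?inE ?eqxx ?orbT.
Qed.

Let T_eq0 p q s : `|p| < r -> `|q| < r -> `|s| < r -> T p q s = 0.
Proof.
apply: (triangle_vanishes KA _ T_affine) => x y z xr yr zr.
by rewrite (T_medial xr yr zr) !(le_trans (ler_normD _ _))// lerD2r
  (le_trans (ler_normD _ _))// lerD2r ler_normD.
Qed.

(** The triangle 0, [z], [z + h] turns the increment of [J 0] into an integral over the short
    segment from [z] to [z + h], on which [K] is close to [K z] by continuity. *)
Theorem goursat_primitive : exists P : 'rV[R]_n -> 'rV[R]_n,
  forall z, `|z| < r -> differentiable P z /\ forall h, 'd P z h = K z ** h.
Proof.
have [M M_gt0 AM] := amul_bounded A.
exists (J 0) => z zr.
have [||dP PE] := @norm_le_differentiable R _ _ (J 0) z (amul A (K z)).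
- exact: rV_linear_continuous.
- move=> e e0.
  have eM : 0 < e / M by rewrite divr_gt0.
  have /cvgrPdist_le/(_ _ eM)/nbhs_ballP[d /= d0 dK] := K_continuous zr.
  exists (Num.min d (r - `|z|)); first by rewrite lt_min d0 subr_gt0.
  move=> h; rewrite lt_min => /andP[hd hr].
  have r0 : `|0 : 'rV[R]_n| < r by rewrite normr0 (le_lt_trans _ zr).
  have zhr : `|z + h| < r.
    by rewrite (le_lt_trans (ler_normD _ _))// -ltrBrDl.
  have -> : J 0 (z + h) - J 0 z = J z (z + h).
    have := T_eq0 r0 zr zhr; rewrite /T (J_sym r0 zhr) => /eqP.
    by rewrite subr_eq0 => /eqP <-; rewrite addrC addKr.
  have -> : J z (z + h) - K z ** h = J z (z + h) - (K z ** (z + h) - K z ** z).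
    by rewrite amulDr [K z ** z + _]addrC addrK.
  have := @segment_integral_near R n A K (fun=> K z) (amul A (K z)) z (z + h) _
    M (e / M) (JP zr zhr) AM (ltW M_gt0).
  rewrite (_ : M * (e / M) = e); last by rewrite mulrC divfK ?gt_eqF.
  rewrite [z + h]addrC addrK; apply.
  + move=> t t01; split; first exact/linear_differentiable/rV_linear_continuous.
    by rewrite diff_lin//; exact: rV_linear_continuous.
  + move=> t t01; rewrite distrC; apply: dK.
    rewrite -ball_normE /= opprD addrA subrr sub0r normrN normrZ.
    move: t01 => /andP[t0 t1]; rewrite ger0_norm// (le_lt_trans _ hd)//.
    by rewrite ler_piMl.
by split=> // h; rewrite PE.
Qed.

End Goursat.

(** * Inverses near the unit and the ideal generated by an element *)

Section Inverse.
Variables (R : realType) (n : nat) (A : algebraOn R n).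
Local Notation "x ** y" := (amul A x y) (at level 40, left associativity).
Local Notation e := (aunit A).

(* Junk value when multiplication by [x] is not invertible. *)
Definition ainv (x : 'rV[R]_n) : 'rV[R]_n := e *m invmx (lin1_mx (amul A x)).

(** For [x] within [(2 * M)^-1] of the unit, [y] has norm at most twice that of [x ** y].
    Multiplication by [x] is thus injective, hence bijective in finite dimension, and the same
    inequality at [y = ainv x] bounds the inverse. *)
Lemma ainv_near_unit : exists2 d, 0 < d & exists2 C, 0 <= C &
  forall x, `|x - e| < d -> x ** ainv x = e /\ `|ainv x| <= C.
Proof.
have [M M0 AM] := amul_bounded A.
have half x y : `|x - e| < (2 * M)^-1 -> `|y| <= 2 * `|x ** y|.
  move=> xd; have yE : y = x ** y + (e - x) ** y.
    by rewrite amulBl amul1 addrC subrK.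
  have h1 : `|y| <= `|x ** y| + `|(e - x) ** y| by rewrite {1}yE ler_normD.
  have h2 : `|(e - x) ** y| <= 2^-1 * `|y|.
    rewrite (le_trans (AM _ _))// ler_wpM2r// mulrC distrC.
    rewrite -ler_pdivlMr//; apply: ltW; rewrite (lt_le_trans xd)//.
    by rewrite invfM.
  lra.
exists (2 * M)^-1; first by rewrite invr_gt0 mulr_gt0.
exists (2 * `|e|); first by rewrite mulr_ge0.
move=> x xd; suff xv : x ** ainv x = e.
  by split=> //; rewrite -[in leRHS]xv; exact: half.
rewrite -(mul_rV_lin1 (amul A x)) mulmxKV// -row_free_unit -kermx_eq0.
apply/rowV0P => y /sub_kermxP; rewrite mul_rV_lin1 /= => xy0.
have := half x y xd; rewrite xy0 normr0 mulr0 => y0.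
by apply/normr0_eq0/eqP; rewrite eq_le y0 normr_ge0.
Qed.

(** With [v] and [v'] the inverses of [x] and [x + h], the resolvent identity
    [v' - v = - (v ** v' ** h)], used twice, leaves the remainder [v ** v ** v' ** h ** h], which is
    quadratic in [h] by the uniform bound on inverses. *)
Lemma differentiable_ainv : exists2 d, 0 < d &
  forall x, `|x - e| < d -> x ** ainv x = e /\
    (differentiable ainv x /\ forall h, 'd ainv x h = - (ainv x ** ainv x) ** h).
Proof.
have [d d0 [C C0 inv]] := ainv_near_unit; exists d => // x xd.
have [xv vC] := inv x xd; split=> //.
have [M M0 AM] := amul_bounded A.
have [||dE EE] := @norm_le_differentiable R _ _ ainv x
    (amul A (- (ainv x ** ainv x))).
- exact: rV_linear_continuous.
- move=> eps eps0.
  pose B := M * (M * (M * (M * C * C) * C)) + 1.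
  have B0 : 0 < B by rewrite ltr_wpDl// !mulr_ge0// ltW.
  exists (Num.min (d - `|x - e|) (eps / B)).
    by rewrite lt_min subr_gt0 xd divr_gt0.
  move=> h; rewrite lt_min ltr_pdivlMr// => /andP[hd heps].
  have xhd : `|x + h - e| < d.
    by rewrite addrAC (le_lt_trans (ler_normD _ _))// -ltrBrDl.
  have [xv' vC'] := inv _ xhd.
  set v := ainv x in xv vC *; set v' := ainv (x + h) in xv' vC' *.
  have vv' : v' - v = - (v ** v' ** h).
    have -> : v' - v = v' ** (x ** v) - v ** ((x + h) ** v').
      by rewrite xv xv' !amulr1.
    rewrite amulDl amulDr (amulCA A v x v') (amulCA A v' x v) (amulC A v' v).
    by rewrite opprD addrA subrr sub0r (amulC A h) amulA.
  have -> : v' - v - - (v ** v) ** h = v ** v ** v' ** h ** h.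
    rewrite -[- (v ** v)]sub0r amulBl amul0l sub0r opprK.
    have -> : v ** v ** v' ** h ** h = - (v ** h ** (v' - v)).
      rewrite vv' -sub0r -[- (_ ** h)]sub0r !amulBr !amulr0 !sub0r opprK.
      by rewrite !amulA (amulAC A v h v) (amulAC A (v ** v) h v').
    rewrite amulBr opprB addrC vv'.
    by rewrite (amulAC A v v' h) (amulAC A v h v).
  rewrite (le_trans (AM _ _))// ler_wpM2r//.
  have AMC x' y' a b : `|x'| <= a -> `|y'| <= b -> `|x' ** y'| <= M * a * b.
    move=> xa yb; rewrite (le_trans (AM _ _))// ler_pM ?mulr_ge0 ?(ltW M0)//.
    by rewrite ler_wpM2l// ltW.
  rewrite (@le_trans _ _ (M * (M * (M * (M * C * C) * C) * `|h|)))//.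
    by rewrite ler_wpM2l ?(ltW M0)// (AMC _ _ _ _ (AMC _ _ _ _ (AMC _ _ _ _ vC vC) vC') (lexx _)).
  rewrite (le_trans _ (ltW heps))// [leRHS]mulrC mulrA ler_wpM2r// /B.
  by rewrite lerDl.
by split=> // h; rewrite EE.
Qed.

End Inverse.

Section IdealProjection.
Variables (R : realType) (n : nat) (A : algebraOn R n).
Local Notation "x ** y" := (amul A x y) (at level 40, left associativity).
Variable a : 'rV[R]_n.

(* [a ** adiv x = x] holds exactly when [x] lies in the ideal [aA], which is the
   kernel of [acoker]. *)
Definition adiv : 'rV[R]_n -> 'rV[R]_n := mulmxr (pinvmx (lin1_mx (amul A a))).
HB.instance Definition _ := GRing.Linear.on adiv.

Definition acoker : 'rV[R]_n -> 'rV[R]_n :=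
  mulmxr (1%:M - pinvmx (lin1_mx (amul A a)) *m lin1_mx (amul A a)).
HB.instance Definition _ := GRing.Linear.on acoker.

Lemma acokerE x : acoker x = x - a ** adiv x.
Proof. by rewrite /acoker /adiv /= mulmxBr mulmx1 mulmxA mul_rV_lin1. Qed.

Lemma amul_adivK x : a ** adiv (a ** x) = a ** x.
Proof.
rewrite /adiv /= -[RHS](mul_rV_lin1 (amul A a)) -[LHS](mul_rV_lin1 (amul A a)).
by rewrite -(mul_rV_lin1 (amul A a) x) mulmxKpV// submxMl.
Qed.

Lemma acoker_amul x : acoker (a ** x) = 0.
Proof. by rewrite acokerE amul_adivK subrr. Qed.

Lemma acoker_eq0 x : acoker x = 0 -> a ** adiv x = x.
Proof. by rewrite acokerE => /subr0_eq. Qed.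

(* The derivative of F along the ideal [aA] stays in [aA]. *)
Lemma acoker_coset (Omega : set 'rV[R]_n) F w x :
  A_differentiable A Omega F ->
  (forall t : R, 0 <= t <= 1 -> Omega (w + t *: (a ** x))) ->
  acoker (F (w + a ** x)) = acoker (F w).
Proof.
move=> /A_differentiableP[F' FE] Ox.
apply/subr0_eq/normr0_eq0/eqP; rewrite eq_le normr_ge0 andbT.
have wE : w + a ** x - w = a ** x by rewrite addrC addKr.
have dF (t : R) : 0 <= t <= 1 ->
    differentiable (acoker \o F) (w + t *: (a ** x)) /\
    'd (acoker \o F) (w + t *: (a ** x)) (a ** x) = 0.
  move=> t01; have [dFt dFE] := FE _ (Ox t t01).
  have [dQ dQE] := diff_linear_comp acoker dFt; split; first exact: dQ.
  apply: etrans (dQE _) _; apply: etrans (congr1 acoker (dFE _)) _.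
  by rewrite amulCA acoker_amul.
apply: (@mean_value_segment R _ _ (acoker \o F) w (w + a ** x) 0) => t t01;
  rewrite wE; have [dt dE] := dF t t01; first exact: dt.
by rewrite dE normr0.
Qed.

End IdealProjection.

(** * Straightening the equation *)

Section NormTools.
Variables (R : realType) (V W : normedModType R).

Lemma continuous_norm_lt (f : V -> W) x : {for x, continuous f} ->
  forall e, 0 < e -> exists2 d, 0 < d & forall y, `|y - x| < d -> `|f y - f x| < e.
Proof.
move=> cf e e0; have /cvgrPdist_lt/(_ _ e0)/nbhs_ballP[d /= d0 df] := cf.
exists d => // y yd; rewrite distrC; apply: df.
by rewrite -ball_normE /= distrC.
Qed.

Lemma open_norm_lt (O : set V) x : open O -> O x ->
  exists2 d, 0 < d & forall y, `|y - x| < d -> O y.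
Proof.
move=> oO Ox; have /nbhs_ballP[d /= d0 dO] := open_nbhs_nbhs (conj oO Ox).
by exists d => // y yd; apply: dO; rewrite -ball_normE /= distrC.
Qed.

End NormTools.

Lemma differentiable_affine (R : realType) m n (c : 'rV[R]_n)
    (L : {linear 'rV[R]_m -> 'rV[R]_n}) y :
  differentiable (fun x => c + L x) y /\ forall h, 'd (fun x => c + L x) y h = L h.
Proof.
have [||dE EE] := @norm_le_differentiable R _ _ (fun x => c + L x) y L.
- exact: rV_linear_continuous.
- move=> e e0; exists 1 => // h _; rewrite linearD.
  rewrite (_ : _ - L h = 0) ?normr0 ?mulr_ge0 ?(ltW e0)//.
  by rewrite addrA [c + _ + _]addrC addrK subrr.
by split=> // h; rewrite EE.
Qed.

Section Straightening.
Variables (R : realType) (n : nat) (A : algebraOn R n).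
Local Notation "x ** y" := (amul A x y) (at level 40, left associativity).
Local Notation e := (aunit A).
Variables (Omega : set 'rV[R]_n) (F : 'rV[R]_n -> 'rV[R]_n) (w0 : 'rV[R]_n).
Hypotheses (openO : open Omega) (FA : A_differentiable A Omega F) (Ow0 : Omega w0).
Local Notation a := (F w0).
Local Notation S := (adiv A a).
Implicit Types (h x y z : 'rV[R]_n).

(* [P] is a primitive of [a ** v y] with [v y] the inverse of [u y], so a
   solution [w0 + a ** y] of the equation satisfies [d(P y) = a ** dphi].  The
   contraction property lets one solve for [y] modulo the annihilator of [a]. *)
Lemma straightening : exists (r : R) (u v P : 'rV[R]_n -> 'rV[R]_n),
  [/\ 0 < r,
    forall y, `|y| < r -> [/\ Omega (w0 + a ** y), F (w0 + a ** y) = a ** u y &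
      u y ** v y = e],
    forall y, `|y| < r -> [/\ differentiable P y,
      forall h, 'd P y h = a ** v y ** h & a ** S (P y) = P y],
    P 0 = 0 &
    forall y y', `|y| < r -> `|y'| < r ->
      `|S (a ** y - P y) - S (a ** y' - P y')| <= 2^-1 * `|y - y'| ].
Proof.
have [F' FE] := (A_differentiableP _ _ _).1 FA.
have [rho rho0 rhoO] := open_norm_lt openO Ow0.
have [Ca Ca0 aC] := rV_linear_bounded (amul A a).
have [CS CS0 SC] := rV_linear_bounded S.
have [M M0 AM] := amul_bounded A.
have [di di0 inv] := differentiable_ainv A.
pose g y := w0 + a ** y.
(* [a] annihilates [e - S a], so the correction does not affect [a ** u y]; it gives [u 0 = e],
   whereas [S a] alone may fail to be a unit. *)
pose u y := (e - S a) + S (F (g y)).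
have g_near y : `|y| < rho / Ca -> `|g y - w0| < rho.
  by rewrite ltr_pdivlMr// => yr; rewrite addrC addKr (le_lt_trans (aC y))// mulrC.
have dg y : differentiable g y /\ forall h, 'd g y h = a ** h.
  exact: differentiable_affine.
have du y : `|y| < rho / Ca -> differentiable u y /\
    forall h, 'd u y h = S (F' (g y) ** (a ** h)).
  move=> /g_near/rhoO/FE[dF dFE]; have [dgy dgE] := dg y.
  have dFg : differentiable (F \o g) y by apply: differentiable_comp.
  have [dS dSE] := diff_linear_comp S dFg.
  have [dT dTE] := differentiable_affine (e - S a) idfun (S (F (g y))).
  split; first exact: (differentiable_comp dS dT).
  move=> h; apply: etrans (diff_comp_apply dS dT h) _.
  apply: etrans (dTE _) _; apply: etrans (dSE _) _; congr (S _).
  by apply: etrans (diff_comp_apply dgy dF h) _; rewrite dFE dgE.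
have g0 : g 0 = w0 by rewrite /g amulr0 addr0.
have u0 : u 0 = e by rewrite /u g0 subrK.
have rC0 : 0 < rho / Ca by rewrite divr_gt0.
have uc : {for 0, continuous u}.
  by apply: differentiable_continuous; have [] := du 0; rewrite ?normr0.
have [r1 r10 r1u] := continuous_norm_lt uc di0.
have ee : `|e - e| < di by rewrite subrr normr0.
have inv_e : ainv A e = e.
  by have [] := inv e ee; rewrite amul1.
have vc : {for 0, continuous (fun y => ainv A (u y))}.
  apply: (continuous_comp uc); rewrite u0; apply: differentiable_continuous.
  by have [_ [? _]] := inv e ee.
(* Chosen so that [CS * Ca * M * eta] is one half, the contraction factor claimed. *)
pose eta := (2 * CS * Ca * M)^-1.
have eta0 : 0 < eta by rewrite invr_gt0 !mulr_gt0.
have [r2 r20 r2v] := continuous_norm_lt vc eta0.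
pose r := Num.min (rho / Ca) (Num.min r1 r2).
have r0 : 0 < r by rewrite !lt_min rC0 r10 r20.
pose v y := ainv A (u y).
have rP y : `|y| < r -> [/\ `|y| < rho / Ca, `|u y - e| < di & `|v y - e| < eta].
  rewrite !lt_min => /and3P[y1 y2 y3]; split=> //.
    by rewrite -u0; apply: r1u; rewrite subr0.
  by rewrite -[X in _ - X]inv_e -u0; apply: r2v; rewrite subr0.
have aSa : a ** S a = a by have := amul_adivK A a e; rewrite amulr1.
have Fu y : `|y| < r -> F (g y) = a ** u y.
  move=> /rP[yr _ _]; rewrite amulDr amulBr amulr1 aSa subrr add0r.
  (* Modulo [aA], [F (g y)] equals [F w0 = a], which is zero there. *)
  apply/esym/acoker_eq0; rewrite (acoker_coset (A := A) (Omega := Omega))//.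
    by rewrite acokerE aSa subrr.
  move=> t /andP[t0 t1]; rewrite -amulZr; apply/rhoO/g_near.
  by rewrite normrZ ger0_norm// (le_lt_trans _ yr)// ler_piMl.
(* [S] is only real linear, so [v] need not be [A]-differentiable. The factor [a] repairs this,
   since [a ** S (a ** x) = a ** x] removes [S] from the derivative. *)
pose K y := a ** v y.
have KA : A_differentiable A [set z | `|z| < r] K.
  apply/A_differentiableP.
  exists (fun y => - (v y ** v y) ** F' (g y) ** a) => y /= /rP[yr1 yr2 _].
  have [duy duE] := du y yr1; have [_ [di_y diE]] := inv _ yr2.
  have dv : differentiable (ainv A \o u) y by exact: differentiable_comp.
  have [dK dKE] := diff_linear_comp (amul A a) dv.
  split; first exact: dK.
  move=> h; apply: etrans (dKE h) _.
  have -> : 'd (ainv A \o u) y h = - (v y ** v y) ** S (F' (g y) ** (a ** h)).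
    apply: etrans (diff_comp_apply duy di_y h) _.
    by apply: etrans (diE _) _; rewrite duE.
  rewrite /= (amulCA A (F' (g y)) a h) (amulCA A a (- _)) amul_adivK.
  by rewrite (amulCA A a) !amulA.
have [P0 dP0] := goursat_primitive KA.
pose P y := - P0 0 + P0 y.
have dP y : `|y| < r -> differentiable P y /\ forall h, 'd P y h = a ** v y ** h.
  move=> /dP0[dPy dPE].
  have [dT dTE] := differentiable_affine (- P0 0) idfun (P0 y).
  split; first exact: (differentiable_comp dPy dT).
  move=> h; apply: etrans (diff_comp_apply dPy dT h) _.
  by apply: etrans (dTE _) _; rewrite dPE.
have P00 : P 0 = 0 by rewrite /P addNr.
have norm0r : `|0 : 'rV[R]_n| < r by rewrite normr0.
(* The differential of [P] takes values in [aA] and [P] vanishes at 0, so [P] stays in [aA]. *)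
have PS y : `|y| < r -> a ** S (P y) = P y.
  move=> yr; apply: acoker_eq0; rewrite -[RHS](linear0 (acoker A a)) -P00.
  apply/subr0_eq/normr0_eq0/eqP; rewrite eq_le normr_ge0 andbT.
  have dQP (t : R) : 0 <= t <= 1 ->
      differentiable (acoker A a \o P) (0 + t *: (y - 0)) /\
      'd (acoker A a \o P) (0 + t *: (y - 0)) (y - 0) = 0.
    move=> t01; have [dPt dPE] := dP _ (norm_segment_lt t01 norm0r yr).
    have [dQ dQE] := diff_linear_comp (acoker A a) dPt.
    split; first exact: dQ.
    apply: etrans (dQE _) _; apply: etrans (congr1 _ (dPE _)) _.
    by rewrite -amulA /= acoker_amul.
  apply: (@mean_value_segment R _ _ (acoker A a \o P) 0 y 0) => t t01;
    have [dt dE] := dQP t t01; first exact: dt.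
  by rewrite dE normr0.
exists r, u, v, P; split; [exact: r0| | |exact: P00|].
- move=> y yr; split; [|exact: Fu|].
    by have [yr1 _ _] := rP y yr; exact/rhoO/g_near.
  by have [_ yr2 _] := rP y yr; have [] := inv _ yr2.
- by move=> y yr; have [dPy dPE] := dP y yr; split=> //; exact: PS.
- move=> y y' yr yr'.
  pose N x := S (a ** x - P x).
  have dN x : `|x| < r -> differentiable N x /\
      forall h, 'd N x h = S (a ** ((e - v x) ** h)).
    move=> xr; have [dPx dPE] := dP x xr.
    have da : differentiable (amul A a) x.
      exact/linear_differentiable/rV_linear_continuous.
    have daP : differentiable (amul A a \- P) x by exact: differentiableB.
    have [dSx dSE] := diff_linear_comp S daP.
    split; first exact: dSx.
    move=> h; apply: etrans (dSE h) _; congr (S _).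
    apply: etrans (congr1 (@^~ h) (diffB da dPx)) _.
    rewrite amulBl amul1 amulBr amulA -dPE; congr (_ - _).
    exact: (congr1 (@^~ h) (diff_lin x (@rV_linear_continuous _ _ _ (amul A a)))).
  apply: (@mean_value_segment R _ _ N y' y) => t t01;
    have [dNx dNE] := dN _ (norm_segment_lt t01 yr' yr); first exact: dNx.
  rewrite dNE (le_trans (SC _))// -ler_pdivlMl// (le_trans (aC _))//.
  rewrite -ler_pdivlMl// (le_trans (AM _ _))//.
  have [_ _] := rP _ (norm_segment_lt t01 yr' yr); rewrite distrC => /ltW veta.
  apply: (@le_trans _ _ (M * eta * `|y - y'|)).
    by rewrite ler_wpM2r// ler_wpM2l// ltW.
  rewrite /eta le_eqVlt; apply/orP; left; apply/eqP; field.
  by rewrite !gt_eqF.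
Qed.

End Straightening.

(** Iteration from 0. As [|z| < r / 4], a point of norm at most [r / 2] is sent to one of norm at
    most [r / 4 + r / 4], so the limit stays strictly inside the open ball where the contraction
    estimate holds. *)
Lemma contraction_fixpoint (R : realType) n (N : 'rV[R]_n -> 'rV[R]_n) (r : R) z :
  N 0 = 0 ->
  (forall y y', `|y| < r -> `|y'| < r -> `|N y - N y'| <= 2^-1 * `|y - y'|) ->
  `|z| < r / 4 -> exists2 y, `|y| < r & y = N y + z.
Proof.
move=> N0 Nc zr.
have r0 : 0 < r by have := normr_ge0 z; lra.
have norm0r : `|0 : 'rV[R]_n| < r by rewrite normr0.
pose u := fix u k := if k is j.+1 then N (u j) + z else 0.
have uE k : u k.+1 = N (u k) + z by [].
have ur k : `|u k| <= r / 2.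
  elim: k => [|k IH] /=; first by rewrite normr0 divr_ge0// ltW.
  have := Nc (u k) 0; rewrite N0 !subr0 => /(_ _ norm0r) Nu.
  rewrite (le_trans (ler_normD _ _))//.
  have {}Nu : `|N (u k)| <= 2^-1 * `|u k| by apply: Nu; lra.
  lra.
have ur' k : `|u k| < r by have := ur k; lra.
have uS k : `|u k.+1 - u k| <= (r / 4) / 2 ^+ k.
  elim: k => [|k IH].
    by rewrite expr0 invr1 mulr1 /= N0 add0r subr0 ltW.
  rewrite half_expS [u k.+2]uE [X in _ - X]uE opprD addrACA subrr addr0.
  by rewrite (le_trans (Nc _ _ (ur' _) (ur' _)))// ler_wpM2l// invr_ge0.
have [l lu] := geometric_steps_limit uS.
have lr : `|l| < r.
  suff : `|l| <= r / 2 by lra.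
  apply/ler_addgt0Pr => e e0; have [k ke] := @exists_half_exp_lt R (2 * (r / 4)) e e0.
  rewrite -[l](subrK (u k)) addrC (le_trans (ler_normD _ _))// lerD//.
  by rewrite distrC (le_trans (lu k))// mulrA ltW.
exists l => //; apply/subr0_eq/normr0_eq0/eqP; rewrite eq_le normr_ge0 andbT.
apply/ler_addgt0Pr => e e0; rewrite add0r.
have [k ke] := @exists_half_exp_lt R (4 * (r / 4)) e e0.
have -> : l - (N l + z) = (l - u k.+1) + (N (u k) - N l).
  by rewrite uE; apply/rowP => i; rewrite !mxE; ring.
rewrite (le_trans (ler_normD _ _))//.
have h1 := lu k.+1; rewrite half_expS distrC in h1.
have h2 := Nc _ _ (ur' k) lr; have h3 := lu k.
have hk : 4 * (r / 4) / 2 ^+ k = 4 * (r / 4 / 2 ^+ k) by rewrite -!mulrA.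
move: hk ke h1 h2 h3; move: (r / 4 / 2 ^+ k) => t; lra.
Qed.

(** * Existence and uniqueness of solutions *)

Section LocalSolution.
Variables (R : realType) (n : nat) (A : algebraOn R n).
Local Notation "x ** y" := (amul A x y) (at level 40, left associativity).

Variables (Omega : set 'rV[R]_n) (F : 'rV[R]_n -> 'rV[R]_n) (w0 : 'rV[R]_n).
Hypotheses (openO : open Omega) (FA : A_differentiable A Omega F) (Ow0 : Omega w0).
Local Notation a := (F w0).
Local Notation S := (adiv A a).

(** The selected fixed point [Y] is only shown to be Lipschitz, but [a ** Y] is differentiable:
    expanding [P] at [y] gives [a ** v y ** (y' - y) = a ** h] up to a small error, and multiplying
    by [u y] isolates [a ** (y' - y)]. *)
Lemma local_lorch_solution p0 :
  exists (rho : R) (W : 'rV[R]_n -> 'rV[R]_n), [/\ 0 < rho, W p0 = w0 &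
    forall p, `|p - p0| < rho -> [/\ Omega (W p), differentiable W p &
      forall h, 'd W p h = F (W p) ** h] ].
Proof.
have [r [u [v [P [r0 uP dP P0 Nc]]]]] := straightening openO FA Ow0.
have [M M0 AM] := amul_bounded A.
have [Ca Ca0 aC] := rV_linear_bounded (amul A a).
have [CS CS0 SC] := rV_linear_bounded S.
(* A fixed point [y] of [N + z] satisfies [P y = a ** z]. *)
pose N y := S (a ** y - P y).
have N0 : N 0 = 0 by rewrite /N amulr0 P0 subr0 linear0.
have norm0r : `|0 : 'rV[R]_n| < r by rewrite normr0.
have /choice[Y YP] z : exists y, `|z| < r / 4 -> `|y| < r /\ y = N y + z.
  have [zr|zr] := ltP `|z| (r / 4); last by exists 0.
  by have [y yr yE] := contraction_fixpoint N0 Nc zr; exists y.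
have YC z z' : `|z| < r / 4 -> `|z'| < r / 4 -> `|Y z - Y z'| <= 2 * `|z - z'|.
  move=> /YP[yr yE] /YP[yr' yE'].
  have : `|Y z - Y z'| <= 2^-1 * `|Y z - Y z'| + `|z - z'|.
    rewrite {1}yE {1}yE' opprD addrACA (le_trans (ler_normD _ _))// lerD2r.
    exact: Nc.
  lra.
have Y0 : Y 0 = 0.
  have [|yr yE] := YP 0 _; first by rewrite normr0 divr_gt0.
  have := Nc _ _ yr norm0r; rewrite -!/(N _) N0 !subr0.
  rewrite -{1}[N _]addr0 -yE => h.
  by apply/normr0_eq0/eqP; rewrite eq_le normr_ge0 andbT; lra.
have YPE z : `|z| < r / 4 -> P (Y z) = a ** z.
  move=> /YP[yr yE]; have [_ _ aSP] := dP _ yr.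
  have : a ** Y z = a ** (N (Y z) + z) by rewrite -yE.
  rewrite /N linearB amulDr amulBr amul_adivK aSP => /eqP.
  by rewrite -subr_eq0 opprD addrA opprB addrCA subrr addr0 subr_eq0 => /eqP.
pose Z p := S (a ** (p - p0)).
have ZC p p' : `|Z p - Z p'| <= CS * Ca * `|p - p'|.
  rewrite /Z -linearB -amulBr opprB addrA subrK -mulrA.
  by rewrite (le_trans (SC _))// ler_wpM2l ?aC// ltW.
have Zp0 : Z p0 = 0 by rewrite /Z subrr amulr0 linear0.
have CC0 : 0 < CS * Ca by rewrite mulr_gt0.
pose rho := (r / 4) / (CS * Ca).
have Zr p : `|p - p0| < rho -> `|Z p| < r / 4.
  rewrite ltr_pdivlMr// => pr; rewrite -[Z p]subr0 -Zp0.
  by rewrite (le_lt_trans (ZC _ _))// mulrC.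
exists rho, (fun p => w0 + a ** Y (Z p)); split.
- by rewrite !divr_gt0.
- by rewrite Zp0 Y0 amulr0 addr0.
move=> p pr; have [yr yE] := YP _ (Zr p pr).
have [Oy Fy uv] := uP _ yr; have [dPy dPE _] := dP _ yr.
rewrite Fy; set y := Y (Z p) in yr yE Oy Fy uv dPy dPE *.
have [||dW WE] := @norm_le_differentiable R _ _ (fun p => w0 + a ** Y (Z p)) p
    (amul A (a ** u y)).
- exact: rV_linear_continuous.
- move=> e e0; pose B := M * (`|u y| + 1) * (2 * (CS * Ca)).
  have B0 : 0 < B by rewrite !mulr_gt0// ltr_wpDl.
  have eB : 0 < e / B by rewrite divr_gt0.
  have [d d0 dPd] := differentiable_norm_le dPy eB.
  exists (Num.min (d / (2 * (CS * Ca))) (rho - `|p - p0|)).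
    by rewrite lt_min subr_gt0 pr divr_gt0// mulr_gt0.
  move=> h; rewrite lt_min ltr_pdivlMr ?mulr_gt0// => /andP[hd hr].
  have phr : `|p + h - p0| < rho.
    by rewrite addrAC (le_lt_trans (ler_normD _ _))// -ltrBrDl.
  set y' := Y (Z (p + h)).
  have yy' : `|y' - y| <= 2 * (CS * Ca) * `|h|.
    rewrite (le_trans (YC _ _ (Zr _ phr) (Zr _ pr)))// -mulrA ler_wpM2l//.
    by rewrite (le_trans (ZC _ _))// [p + h]addrC addrK.
  have yy'd : `|y' - y| < d by rewrite (le_lt_trans yy')// mulrC.
  have := dPd (y' - y) yy'd.
  rewrite [y + _]addrC subrK dPE !YPE ?Zr//.
  have -> : a ** Z (p + h) - a ** Z p = a ** h.
    by rewrite /Z !amul_adivK -amulBr opprB addrA subrK addrC addKr.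
  set rest := a ** h - _ => restP.
  have -> : w0 + a ** y' - (w0 + a ** y) - a ** u y ** h = - (u y ** rest).
    have -> : u y ** rest = a ** u y ** h - a ** (y' - y).
      rewrite /rest amulBr; congr (_ - _).
        by rewrite amulA (amulC A (u y)).
      rewrite !amulA (amulC A (u y)) -(amulA A a) uv amulr1//.
    by rewrite amulBr; apply/rowP => i; rewrite !mxE; ring.
  rewrite normrN (le_trans (AM _ _))//.
  apply: (@le_trans _ _ (M * (`|u y| + 1) * (e / B * (2 * (CS * Ca) * `|h|)))).
    apply: ler_pM => //; first by rewrite mulr_ge0// ltW.
      by apply: ler_wpM2l; [exact: ltW|rewrite lerDl].
    by apply: (le_trans restP); apply: ler_wpM2l yy'; exact: ltW.
  have -> : M * (`|u y| + 1) * (e / B * (2 * (CS * Ca) * `|h|)) =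
      e / B * B * `|h| by rewrite /B; ring.
  by rewrite divfK ?gt_eqF.
by split; [exact: Oy|exact: dW|move=> h; exact: (congr1 (@^~ h) WE)].
Qed.

End LocalSolution.

(** A Gronwall argument by maximum: where [|g|] is largest on the segment from [tau0], the mean
    value inequality bounds this maximum by [C * |tau - tau0|] times itself, and the radius
    [(2 * C)^-1] makes that factor at most one half. *)
Lemma homogeneous_differential_inequality (R : realType) k n
    (g : 'rV[R]_k -> 'rV[R]_n) tau0 (d C : R) :
  0 < d -> 0 < C -> g tau0 = 0 ->
  (forall tau, `|tau - tau0| < d -> differentiable g tau /\
     forall xi, `|'d g tau xi| <= C * `|g tau| * `|xi|) ->
  exists2 d', 0 < d' & forall tau, `|tau - tau0| < d' -> g tau = 0.
Proof.
move=> d0 C0 g0 dg.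
exists (Num.min d (2 * C)^-1); first by rewrite lt_min d0 invr_gt0 mulr_gt0.
move=> tau; rewrite lt_min => /andP[taud tauC].
pose L (t : R) := tau0 + t *: (tau - tau0).
have L_near (t : R) : 0 <= t <= 1 -> `|L t - tau0| < d.
  move=> /andP[t0 t1]; rewrite addrC addKr normrZ ger0_norm//.
  by rewrite (le_lt_trans _ taud)// ler_piMl.
have [c c01 cmax] : exists2 c : R, c \in `[0, 1]%R &
    forall t : R, t \in `[0, 1]%R -> `|g (L t)| <= `|g (L c)|.
  apply: EVT_max; first exact: ler01.
  have : {in `[0, 1]%R, continuous (fun t : R => `|g (L t)|)}.
    move=> t; rewrite in_itv /= => t01.
    apply: (@continuous_comp _ _ _ (fun t : R => g (L t)) (fun x => `|x|)); last first.
      exact: norm_continuous.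
    apply: (@continuous_comp _ _ _ L g).
      by apply: cvgD; [exact: cvg_cst|apply: cvgZr_tmp; exact: cvg_id].
    by apply: differentiable_continuous; have [] := dg _ (L_near t t01).
  by move=> ct; apply: continuous_in_subspaceT => t; rewrite inE => /ct.
have c01' : 0 <= c <= 1 by move: c01; rewrite in_itv.
have gc0 : `|g (L c)| = 0.
  have : `|g (L c) - g tau0| <= C * `|g (L c)| * `|tau - tau0|.
    have LcE : L c - tau0 = c *: (tau - tau0) by rewrite addrC addKr.
    have LsE (s : R) : tau0 + s *: (L c - tau0) = L (s * c).
      by rewrite LcE scalerA.
    have sc01 (s : R) : 0 <= s <= 1 -> 0 <= s * c <= 1.
      move=> /andP[s0 s1]; move: c01' => /andP[c0 c1].
      by rewrite mulr_ge0//= mulr_ile1.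
    apply: (@mean_value_segment R _ _ g tau0 (L c)) => s s01; rewrite LsE.
      by have [] := dg _ (L_near _ (sc01 s s01)).
    have [_ dgs] := dg _ (L_near _ (sc01 s s01)).
    apply: (le_trans (dgs _)); apply: ler_pM => //.
    - by rewrite mulr_ge0// ltW.
    - by rewrite ler_pM2l//; apply: cmax; rewrite in_itv; exact: sc01.
    - move: c01' => /andP[c0 c1].
      by rewrite LcE normrZ ger0_norm// ler_piMl.
  rewrite g0 subr0 => h.
  have h2 : C * `|tau - tau0| <= 2^-1.
    by rewrite -ler_pdivlMl// -invfM mulrC ltW.
  have h3 : C * `|g (L c)| * `|tau - tau0| <= 2^-1 * `|g (L c)|.
    by rewrite mulrAC ler_wpM2r.
  by have := normr_ge0 (g (L c)); lra.
have := cmax 1; rewrite in_itv /= ler01 lexx gc0 => /(_ isT).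
rewrite /L scale1r addrC subrK => gt0.
by apply/normr0_eq0/eqP; rewrite eq_le gt0 normr_ge0.
Qed.

(** * Local uniqueness *)

Section LocalUniqueness.
Variables (R : realType) (k n : nat) (A : algebraOn R n).
Local Notation "x ** y" := (amul A x y) (at level 40, left associativity).
Variables (Omega : set 'rV[R]_n) (F : 'rV[R]_n -> 'rV[R]_n) (w0 : 'rV[R]_n).
Hypotheses (openO : open Omega) (FA : A_differentiable A Omega F) (Ow0 : Omega w0).
Local Notation a := (F w0).
Local Notation S := (adiv A a).
Local Notation Q := (acoker A a).

(** Write [h = Q h + a ** S h]. Moving along the second summand does not change [Q (F _)], so only
    the increment from [w0] to [w0 + Q h] matters; the expansion of [F] at [w0] with error constant
    1 bounds it linearly in [Q h], and [Q a = 0]. *)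
Lemma acoker_field_bound : exists2 d, 0 < d & exists2 C, 0 < C &
  forall h, `|h| < d -> `|Q (F (w0 + h))| <= C * `|Q h|.
Proof.
have [F' FE] := (A_differentiableP _ _ _).1 FA.
have [rho rho0 rhoO] := open_norm_lt openO Ow0.
have [CQ CQ0 QC] := rV_linear_bounded Q.
have [M M0 AM] := amul_bounded A.
have [dF dFE] := FE _ Ow0.
have [d d0 dFd] := differentiable_norm_le dF ltr01.
exists (Num.min rho (Num.min (rho / CQ) (d / CQ))).
  by rewrite !lt_min rho0 !divr_gt0.
exists (CQ * (M * `|F' w0| + 1)).
  by rewrite mulr_gt0// ltr_wpDl// mulr_ge0// ltW.
move=> h; rewrite !lt_min !ltr_pdivlMr// => /and3P[hrho hQrho hQd].
have Qrho : `|Q h| < rho by rewrite (le_lt_trans (QC h))// mulrC.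
have Qd : `|Q h| < d by rewrite (le_lt_trans (QC h))// mulrC.
have hE : h = Q h + a ** S h by rewrite acokerE subrK.
have -> : Q (F (w0 + h)) = Q (F (w0 + Q h)).
  rewrite {1}hE addrA; apply: (acoker_coset FA) => t t01; apply: rhoO.
  rewrite (_ : w0 + _ + _ - w0 = Q h + t *: (h - Q h)).
    exact: norm_segment_lt.
  rewrite {4}hE [Q h + _ - _]addrC addKr.
  by apply/rowP => i; rewrite !mxE; ring.
have Qa : Q a = 0 by rewrite -[a in Q a](amulr1 A) acoker_amul.
have -> : Q (F (w0 + Q h)) = Q (F (w0 + Q h) - a) by rewrite linearB /= Qa subr0.
rewrite (le_trans (QC _))// -mulrA ler_wpM2l ?(ltW CQ0)// mulrDl mul1r.
have := dFd (Q h) Qd; rewrite mul1r dFE => h1.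
rewrite -[F _ - a](subrK (F' w0 ** Q h)) addrC (le_trans (ler_normD _ _))//.
by rewrite lerD.
Qed.

Variables (phi : 'rV[R]_k -> 'rV[R]_n) (tau0 : 'rV[R]_k).

Definition local_solution (w : 'rV[R]_k -> 'rV[R]_n) (d : R) :=
  w tau0 = w0 /\ forall tau, `|tau - tau0| < d ->
    [/\ Omega (w tau), differentiable w tau &
      forall xi, 'd w tau xi = F (w tau) ** 'd phi tau xi].

Lemma solution_in_coset w (d B : R) : 0 < d -> 0 < B ->
  (forall tau xi, `|tau - tau0| < d -> `|'d phi tau xi| <= B * `|xi|) ->
  local_solution w d ->
  exists2 d', 0 < d' & forall tau, `|tau - tau0| < d' -> Q (w tau - w0) = 0.
Proof.
move=> d0 B0 phiB [ww0 wd].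
have [d1 d10 [C C0 QF]] := acoker_field_bound.
have [CQ CQ0 QC] := rV_linear_bounded Q.
have [M M0 AM] := amul_bounded A.
have cw : {for tau0, continuous w}.
  by apply: differentiable_continuous; have [] := wd tau0; rewrite ?subrr ?normr0.
have [d2 d20 w_near] := continuous_norm_lt cw d10; rewrite ww0 in w_near.
pose D := CQ * (M * C * B).
have D0 : 0 < D by rewrite !mulr_gt0.
have := @homogeneous_differential_inequality R k n
  (fun tau => Q (- w0 + w tau)) tau0 (Num.min d d2) D.
rewrite lt_min d0 d20 ww0 addNr linear0 => /(_ isT D0 erefl) [|d' d'0 gd'].
  move=> tau; rewrite lt_min => /andP[taud taud2].
  have [Ow dw dwE] := wd tau taud.
  have [dT dTE] := differentiable_affine (- w0) idfun (w tau).
  have dTw : differentiable ((fun x => - w0 + idfun x) \o w) tau.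
    exact: differentiable_comp.
  have [dQ dQE] := diff_linear_comp Q dTw.
  split; first exact: dQ.
  move=> xi.
  have -> : 'd (Q \o ((fun x => - w0 + idfun x) \o w)) tau xi =
      Q (F (w tau) ** 'd phi tau xi).
    apply: etrans (dQE xi) _; congr (Q _).
    apply: etrans (diff_comp_apply dw dT xi) _.
    by apply: etrans (dTE _) _; exact: dwE.
  have FE : F (w tau) = Q (F (w tau)) + a ** S (F (w tau)) by rewrite acokerE subrK.
  rewrite {1}FE amulDl -amulA linearD /= acoker_amul addr0.
  have wE : w tau = w0 + (- w0 + w tau) by rewrite addrA subrr add0r.
  have := QF (- w0 + w tau); rewrite -wE => /(_ _) QFw.
  rewrite (le_trans (QC _))// /D -!mulrA ler_wpM2l ?(ltW CQ0)//.
  rewrite (le_trans (AM _ _))// -!mulrA ler_wpM2l ?(ltW M0)//.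
  rewrite mulrA [leRHS](_ : _ = C * `|Q (- w0 + w tau)| * (B * `|xi|)); last by ring.
  apply: ler_pM => //; last exact: phiB.
  by apply: QFw; rewrite addrC; exact: w_near.
by exists d' => // tau taud'; rewrite addrC; exact: gd'.
Qed.

(** For [y = S (w - w0)], the coset property gives [w = w0 + a ** y], hence [F w = a ** u y]. The
    factor [v y] in the differential of [P] cancels [u y], so [P y] and [a ** phi] have the same
    differential. *)
Lemma solution_coordinate (r : R) u v P w (d B : R) :
  (forall y, `|y| < r -> [/\ Omega (w0 + a ** y), F (w0 + a ** y) = a ** u y &
      u y ** v y = aunit A]) ->
  (forall y, `|y| < r -> [/\ differentiable P y,
      forall h, 'd P y h = a ** v y ** h & a ** S (P y) = P y]) ->
  P 0 = 0 -> 0 < r -> 0 < d -> 0 < B ->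
  (forall tau, `|tau - tau0| < d -> differentiable phi tau) ->
  (forall tau xi, `|tau - tau0| < d -> `|'d phi tau xi| <= B * `|xi|) ->
  local_solution w d ->
  exists2 d', 0 < d' & forall tau, `|tau - tau0| < d' ->
    [/\ `|S (- w0 + w tau)| < r, a ** S (- w0 + w tau) = - w0 + w tau &
      P (S (- w0 + w tau)) = a ** phi tau - a ** phi tau0].
Proof.
move=> uP dP P0 r0 d0 B0 dphi phiB wsol.
have [d1 d10 Qw] := solution_in_coset d0 B0 phiB wsol.
have [ww0 wd] := wsol.
pose y tau := S (- w0 + w tau).
have dy tau : `|tau - tau0| < d -> differentiable y tau /\
    forall xi, 'd y tau xi = S (F (w tau) ** 'd phi tau xi).
  move=> taud; have [Ow dw dwE] := wd tau taud.
  have [dT dTE] := differentiable_affine (- w0) idfun (w tau).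
  have dTw : differentiable ((fun x => - w0 + idfun x) \o w) tau.
    exact: differentiable_comp.
  have [dS dSE] := diff_linear_comp S dTw.
  split; first exact: dS.
  move=> xi; apply: etrans (dSE xi) _; congr (S _).
  by apply: etrans (diff_comp_apply dw dT xi) _; apply: etrans (dTE _) _; exact: dwE.
have y0 : y tau0 = 0 by rewrite /y ww0 addNr linear0.
have cy : {for tau0, continuous y}.
  by apply: differentiable_continuous; have [] := dy tau0; rewrite ?subrr ?normr0.
have [d2 d20 y_near] := continuous_norm_lt cy r0.
have min0 : 0 < Num.min d (Num.min d1 d2) by rewrite !lt_min d0 d10 d20.
exists (Num.min d (Num.min d1 d2)) => // tau; rewrite !lt_min => /and3P[tau1 tau2 tau3].
have yr x : `|x - tau0| < d2 -> `|y x| < r.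
  by move=> /y_near; rewrite y0 subr0.
have ayE x : `|x - tau0| < d1 -> a ** y x = - w0 + w x.
  by move=> /Qw; rewrite addrC => /acoker_eq0.
split; [exact: yr|exact: ayE|].
pose f := (P \o y) \- (amul A a \o phi).
have df x : `|x - tau0| < d -> `|x - tau0| < d1 -> `|x - tau0| < d2 ->
    differentiable f x /\ forall xi, 'd f x xi = 0.
  move=> x1 x2 x3; have [dyx dyE] := dy x x1.
  have [dPy dPE _] := dP _ (yr x x3).
  have [_ Fw uv] := uP _ (yr x x3).
  have [daphi daphiE] := diff_linear_comp (amul A a) (dphi x x1).
  have dPy' : differentiable (P \o y) x by exact: differentiable_comp.
  split; first exact: differentiableB.
  move=> xi; apply: etrans (congr1 (@^~ xi) (diffB dPy' daphi)) _.
  apply/eqP; rewrite subr_eq0; apply/eqP.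
  apply: etrans (diff_comp_apply dyx dPy xi) _.
  apply: etrans (dPE _) _; apply: etrans _ (esym (daphiE xi)).
  have yE : 'd y x xi = S (a ** (u (y x) ** 'd phi x xi)).
    apply: etrans (dyE xi) _; congr (S _); rewrite amulA; congr (_ ** _).
    by rewrite -Fw ayE// addrA subrr add0r.
  apply: etrans (congr1 (amul A (a ** v (y x))) yE) _.
  move: ('d phi x xi) => zeta.
  rewrite /= (amulC A a (v _)) -amulA amul_adivK amulCA (amulA A (v _)) (amulC A (v _)).
  by rewrite uv amul1.
have segd (t e : R) : 0 <= t <= 1 -> `|tau - tau0| < e ->
    `|tau0 + t *: (tau - tau0) - tau0| < e.
  move=> /andP[t0 t1] h; rewrite addrC addKr normrZ ger0_norm//.
  by rewrite (le_lt_trans _ h)// ler_piMl.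
have dfs (t : R) : 0 <= t <= 1 -> differentiable f (tau0 + t *: (tau - tau0)) /\
    forall xi, 'd f (tau0 + t *: (tau - tau0)) xi = 0.
  by move=> t01; apply: df; exact: segd.
have fle0 : `|f tau - f tau0| <= 0.
  apply: (@mean_value_segment R _ _ f tau0 tau) => t t01;
    have [dft dfE] := dfs t t01; first exact: dft.
  by rewrite dfE normr0.
have /subr0_eq : f tau - f tau0 = 0.
  by apply/normr0_eq0/eqP; rewrite eq_le fle0 normr_ge0.
rewrite /f /= y0 P0 sub0r => /eqP.
by rewrite subr_eq addrC => /eqP.
Qed.

(** The coordinates [y1], [y2] of the two solutions have the same image under [P] and satisfy
    [S (a ** y) = y], so the contraction estimate bounds their distance by half of itself. *)
Lemma local_uniqueness w1 w2 (d B : R) : 0 < d -> 0 < B ->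
  (forall tau, `|tau - tau0| < d -> differentiable phi tau) ->
  (forall tau xi, `|tau - tau0| < d -> `|'d phi tau xi| <= B * `|xi|) ->
  local_solution w1 d -> local_solution w2 d ->
  exists2 d', 0 < d' & forall tau, `|tau - tau0| < d' -> w1 tau = w2 tau.
Proof.
move=> d0 B0 dphi phiB sol1 sol2.
have [r [u [v [P [r0 uP dP P0 Nc]]]]] := straightening openO FA Ow0.
have [d1 d10 w1P] := solution_coordinate uP dP P0 r0 d0 B0 dphi phiB sol1.
have [d2 d20 w2P] := solution_coordinate uP dP P0 r0 d0 B0 dphi phiB sol2.
exists (Num.min d1 d2); first by rewrite lt_min d10 d20.
move=> tau; rewrite lt_min => /andP[tau1 tau2].
have [yr1 ay1 Py1] := w1P tau tau1; have [yr2 ay2 Py2] := w2P tau tau2.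
have := Nc _ _ yr1 yr2; rewrite Py1 Py2 ay1 ay2.
move: (a ** phi tau - _) => c; rewrite 2!(linearB S _ c) /= opprB addrA subrK.
move: (S (- w0 + w1 tau)) (S (- w0 + w2 tau)) ay1 ay2 => y1 y2 ay1 ay2 h.
have /subr0_eq y12 : y1 - y2 = 0.
  by apply/normr0_eq0/eqP; rewrite eq_le normr_ge0 andbT; lra.
by apply: (addrI (- w0)); rewrite -ay1 -ay2 y12.
Qed.

End LocalUniqueness.

(** Each ['d phi tau (b j)] is differentiable in [tau], hence locally bounded; finitely many basis
    vectors then bound the whole differential on one ball. *)
Lemma classC2_diff_bounded (R : realType) k n (U : set 'rV[R]_k)
    (phi : 'rV[R]_k -> 'rV[R]_n) tau0 :
  open U -> classC 2 U phi -> U tau0 ->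
  exists d B : R, [/\ 0 < d, 0 < B & forall tau, `|tau - tau0| < d ->
    [/\ U tau, differentiable phi tau & forall xi, `|'d phi tau xi| <= B * `|xi|] ].
Proof.
move=> openU [dphi ddphi] Utau0.
have [d1 d10 d1U] := open_norm_lt openU Utau0.
pose b (j : 'I_k) : 'rV[R]_k := delta_mx 0 j.
pose near_bound (j : 'I_k) : set 'rV[R]_k :=
  [set tau | `|'d phi tau (b j)| <= `|'d phi tau0 (b j)| + 1].
have bnear j : nbhs tau0 (near_bound j).
  have [dj _] := ddphi (b j).
  have cj := differentiable_continuous (dj tau0 Utau0).
  have [d d0 dP] := continuous_norm_lt cj ltr01.
  apply/nbhs_ballP; exists d => // tau; rewrite -ball_normE /= distrC => /dP h.
  rewrite /near_bound /= -lerBlDl (le_trans _ (ltW h))//.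
  exact: lerB_dist.
have /nbhs_ballP[d2 /= d20 d2P] : nbhs tau0 (fun tau => forall j, near_bound j tau).
  exact: (@filter_forall _ _ near_bound (nbhs tau0) _ bnear).
exists (Num.min d1 d2), (1 + \sum_j (`|'d phi tau0 (b j)| + 1)); split.
- by rewrite lt_min d10 d20.
- by rewrite ltr_pwDl// sumr_ge0// => j _; rewrite addr_ge0.
move=> tau; rewrite lt_min => /andP[tau1 tau2]; split; [exact: d1U|exact/dphi/d1U|].
have bj : forall j, `|'d phi tau (b j)| <= `|'d phi tau0 (b j)| + 1.
  by have := d2P tau; rewrite -ball_normE /= distrC => /(_ tau2).
move=> xi; apply: (le_trans (norm_linear_le_basis ('d phi tau) xi)).
by rewrite ler_wpM2r// ler_wpDl// ler_sum// => j _; exact: bj.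
Qed.

(** The zero set is relatively open by the last hypothesis and relatively closed by continuity, and
    [0, 1] is connected. *)
Lemma segment_zero_propagation (R : realType) n (f : R -> 'rV[R]_n) :
  (forall t : R, 0 <= t <= 1 -> {for t, continuous f}) -> f 0 = 0 ->
  (forall t : R, 0 <= t <= 1 -> f t = 0 -> \forall s \near t, f s = 0) ->
  f 1 = 0.
Proof.
move=> cf f0 fnear.
pose Z := [set t : R | f t = 0].
have in01 (t : R) : `[0, 1]%classic t = (0 <= t <= 1) :> Prop by rewrite /= in_itv.
suff E : `[0, 1]%classic `&` Z = `[0, 1]%classic :> set R.
  suff [] : (`[0, 1]%classic `&` Z) 1 by [].
  by rewrite E in01 lexx ler01.
apply: (@segment_connected R 0 1).
- by exists 0; split; rewrite //= in_itv /= lexx ler01.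
- exists (interior Z); first exact: open_interior.
  apply/seteqP; split=> t [t01 Zt]; split=> //; last exact: interior_subset Zt.
  by apply: fnear => //; move: t01; rewrite /= in_itv.
- exists (closure Z); first exact: closed_closure.
  apply/seteqP; split=> t [t01 Zt]; split=> //; first exact: subset_closure.
  apply: contrapT => ft0.
  have ft : 0 < `|f t| by rewrite normr_gt0; apply/eqP.
  have t01' : 0 <= t <= 1 by move: t01; rewrite /= in_itv.
  have [d d0 dP] := continuous_norm_lt (cf t t01') ft.
  have [s [Zs ts]] := Zt _ (nbhsx_ballx t d d0).
  have := dP s; rewrite Zs sub0r normrN ltxx => h; suff : false by [].
  apply: h.
  by move: ts; rewrite -ball_normE /= distrC.
Qed.

(** * From local agreement to agreement on a ball *)

Section SolutionsAgree.
Variables (R : realType) (k n : nat) (A : algebraOn R n).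
Variables (U : set 'rV[R]_k) (phi : 'rV[R]_k -> 'rV[R]_n).
Variables (Omega : set 'rV[R]_n) (F : 'rV[R]_n -> 'rV[R]_n).
Hypotheses (openU : open U) (phiC2 : classC 2 U phi).
Hypotheses (openOmega : open Omega) (FA : A_differentiable A Omega F).

(** Local uniqueness restarted at [tau1] with initial value [w tau1]. Allowing distinct domains and
    initial data lets it serve both the propagation along segments and the comparison with solutions
    on other neighborhoods. *)
Lemma solutions_agree_near tau0 w0 tau0' w0' (V V' : set 'rV[R]_k) w w' tau1 :
  open V -> open V' -> V `<=` U -> V tau1 -> V' tau1 ->
  phiA_solution A phi Omega F tau0 w0 V w ->
  phiA_solution A phi Omega F tau0' w0' V' w' ->
  w' tau1 = w tau1 -> \forall tau \near tau1, w' tau = w tau.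
Proof.
move=> oV oV' VU V1 V1' [[_ dw _] wO _ wE] [[_ dw' _] wO' _ wE'] ww'.
have [d1 [B [d10 B0 phiB]]] := classC2_diff_bounded openU phiC2 (VU _ V1).
have [d2 d20 d2V] := open_norm_lt oV V1.
have [d3 d30 d3V] := open_norm_lt oV' V1'.
pose d := Num.min d1 (Num.min d2 d3).
have d0 : 0 < d by rewrite !lt_min d10 d20 d30.
have dP tau : `|tau - tau1| < d -> [/\ `|tau - tau1| < d1, V tau & V' tau].
  by rewrite !lt_min => /and3P[h1 h2 h3]; split; [|exact: d2V|exact: d3V].
have O1 : Omega (w tau1) by apply: wO; exists tau1.
have sol : local_solution A Omega F (w tau1) phi tau1 w d.
  split=> // tau /dP[_ Vt _]; split; [|exact: dw|exact: wE].
  by apply: wO; exists tau.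
have sol' : local_solution A Omega F (w tau1) phi tau1 w' d.
  split=> // tau /dP[_ _ Vt]; split; [|exact: dw'|exact: wE'].
  by apply: wO'; exists tau.
have dphi tau : `|tau - tau1| < d -> differentiable phi tau.
  by move=> /dP[/phiB[_ ? _] _ _].
have phiBd tau xi : `|tau - tau1| < d -> `|'d phi tau xi| <= B * `|xi|.
  by move=> /dP[/phiB[_ _ h] _ _]; exact: h.
have [d' d'0 agree] :=
  local_uniqueness openOmega FA O1 d0 B0 dphi phiBd sol' sol.
apply/nbhs_ballP; exists d' => // tau.
by rewrite -ball_normE /= distrC => /agree.
Qed.

Lemma solutions_agree_ball tau0 w0 (d : R) w w' :
  [set tau | `|tau - tau0| < d] `<=` U ->
  phiA_solution A phi Omega F tau0 w0 [set tau | `|tau - tau0| < d] w ->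
  phiA_solution A phi Omega F tau0 w0 [set tau | `|tau - tau0| < d] w' ->
  forall tau, `|tau - tau0| < d -> w' tau = w tau.
Proof.
move=> VU sol sol' tau taud; set V := [set _ | _] in VU sol sol'.
have oV : open V.
  rewrite (_ : V = ball tau0 d); first exact: ball_open.
  by apply/seteqP; split=> x; rewrite /V -ball_normE /= distrC.
pose L (t : R) := tau0 + t *: (tau - tau0).
have VL (t : R) : 0 <= t <= 1 -> V (L t).
  move=> /andP[t0 t1]; rewrite /V /= addrC addKr normrZ ger0_norm//.
  by rewrite (le_lt_trans _ taud)// ler_piMl.
have cL : continuous L.
  by move=> t; apply: cvgD; [exact: cvg_cst|apply: cvgZr_tmp; exact: cvg_id].
have [[_ dw _] _ ww0 _] := sol; have [[_ dw' _] _ ww0' _] := sol'.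
apply/subr0_eq; have L1 : L 1 = tau by rewrite /L scale1r addrC subrK.
rewrite -L1.
apply: (@segment_zero_propagation R n (fun t => w' (L t) - w (L t))).
- move=> t t01; apply: cvgB.
    apply: (@continuous_comp _ _ _ L w'); first exact: cL.
    by apply: differentiable_continuous; exact: dw' (VL t t01).
  apply: (@continuous_comp _ _ _ L w); first exact: cL.
  by apply: differentiable_continuous; exact: dw (VL t t01).
- by rewrite /L scale0r addr0 ww0 ww0' subrr.
- move=> t t01 /subr0_eq agree.
  have near_w := solutions_agree_near oV oV VU (VL t t01) (VL t t01) sol sol' agree.
  have near_L : \forall s \near t, w' (L s) = w (L s) by exact: (cL t _ near_w).
  near=> s; apply/eqP; rewrite subr_eq0; apply/eqP.
  by near: s.
Unshelve. all: by end_near.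
Qed.

End SolutionsAgree.

Theorem theorem3p2 (R : realType) (k n : nat) (A : algebraOn R n)
    (U : set 'rV[R]_k) (phi : 'rV[R]_k -> 'rV[R]_n)
    (Omega : set 'rV[R]_n) (F : 'rV[R]_n -> 'rV[R]_n) (tau0 : 'rV[R]_k)
    (openU : open U) (phiC2 : classC 2 U phi)
    (openOmega : open Omega) (FA : A_differentiable A Omega F)
    (phiU : phi @` U `<=` Omega) (Utau0 : U tau0) :
  forall w0 : 'rV[R]_n, Omega w0 ->
  exists (V : set 'rV[R]_k) (w : 'rV[R]_k -> 'rV[R]_n),
    [/\ open_nbhs tau0 V, V `<=` U,
        phiA_solution A phi Omega F tau0 w0 V w,
        (* uniqueness on the neighborhood V *)
        forall w' : 'rV[R]_k -> 'rV[R]_n, phiA_solution A phi Omega F tau0 w0 V w' ->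
          forall tau, V tau -> w' tau = w tau &
        (* uniqueness does not depend on the choice of neighborhood *)
        forall (V' : set 'rV[R]_k) (w' : 'rV[R]_k -> 'rV[R]_n),
          open_nbhs tau0 V' -> V' `<=` U ->
          phiA_solution A phi Omega F tau0 w0 V' w' ->
          \forall tau \near tau0, w' tau = w tau].
Proof.
move=> w0 Ow0.
have [rho [W [rho0 Wp0 WP]]] := local_lorch_solution openOmega FA Ow0 (phi tau0).
have [dphi _] := phiC2.
have cphi := differentiable_continuous (dphi _ Utau0).
have [d1 d10 phi_near] := continuous_norm_lt cphi rho0.
have [d2 d20 d2U] := open_norm_lt openU Utau0.
(* [d1] keeps [phi] in the domain of [W], [d2] keeps the ball in [U]. A ball is used so that every
   point is joined to [tau0] by a segment inside it. *)
pose d := Num.min d1 d2.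
pose V := [set tau | `|tau - tau0| < d].
have d0 : 0 < d by rewrite lt_min d10 d20.
have V0 : V tau0 by rewrite /V /= subrr normr0.
have oV : open V.
  rewrite (_ : V = ball tau0 d); first exact: ball_open.
  by apply/seteqP; split=> x; rewrite /V -ball_normE /= distrC.
have VU : V `<=` U by move=> tau; rewrite /V /= lt_min => /andP[_]; exact: d2U.
have VW tau : V tau -> `|phi tau - phi tau0| < rho.
  by rewrite /V /= lt_min => /andP[]; move=> /phi_near.
have dw tau : V tau -> [/\ Omega (W (phi tau)), differentiable (W \o phi) tau &
    forall xi, 'd (W \o phi) tau xi = amul A (F (W (phi tau))) ('d phi tau xi)].
  move=> Vt; have [OW dW dWE] := WP _ (VW _ Vt).
  have dphit := dphi _ (VU _ Vt).
  split; [exact: OW|exact: differentiable_comp|move=> xi].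
  by apply: etrans (diff_comp_apply dphit dW xi) _; exact: dWE.
have sol : phiA_solution A phi Omega F tau0 w0 V (W \o phi).
  split.
  - split; [by move=> u /VU/dphi|by move=> u /dw[]|].
    by exists (F \o (W \o phi)) => u Vu; have [_ _ ?] := dw u Vu.
  - by move=> _ [u Vu <-]; have [] := dw u Vu.
  - exact: Wp0.
  - by move=> tau Vt; have [] := dw tau Vt.
exists V, (W \o phi); split; [by split|exact: VU|exact: sol| |].
- by move=> w' sol'; exact: (solutions_agree_ball openU phiC2 openOmega FA VU sol sol').
- move=> V' w' [oV' V'0] _ sol'.
  apply: (solutions_agree_near openU phiC2 openOmega FA oV oV' VU V0 V'0 sol sol').
  by have [_ _ -> _] := sol'; have [_ _ -> _] := sol.
Qed.
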